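(* Let $f\in\mathbf{R}[y]$ be a monic irreducible quasi-ordinary polynomial of degree $n$ in $y$, with gcd-sequence $(d_1,\ldots,d_h,d_{h+1}=1)$. Let $r_0^1,\ldots,r_0^e$ be the canonical basis of $(n\mathbf{Z})^e$ (that is, $r_0^i$ has $n$ in position $i$ and $0$ elsewhere). Then the semigroup $\Gamma(f)$ is generated by $r_0^1,\ldots,r_0^e$ together with the orders $O(f,\mathrm{App}_{d_k}(f))$, $1\le k\le h$, of the approximate roots of $f$; i.e. $\Gamma(f)$ is the set of all combinations $\sum_{i=1}^e\gamma_i r_0^i+\sum_{k=1}^h\theta_k\,O(f,\mathrm{App}_{d_k}(f))$ with $\gamma_i,\theta_k\in\mathbf{N}=\{0,1,2,\ldots\}$.
   Context: $\mathbf{K}$ is an algebraically closed field of characteristic $0$ and $\mathbf{R}=\mathbf{K}[[x_1,\ldots,x_e]]$. Quasi-ordinary polynomials. A monic $f=y^n+a_1(\underline{x})y^{n-1}+\cdots+a_n(\underline{x})\in\mathbf{R}[y]$ is quasi-ordinary if its discriminant with respect to $y$ has the form $x_1^{N_1}\cdots x_e^{N_e}u(\underline{x})$ with $N_i\in\mathbf{N}$ and $u$ a unit of $\mathbf{R}$. If $f$ is moreover irreducible in $\mathbf{R}[y]$, then by the Abhyankar–Jung theorem there is $y(\underline{t})=\sum_p c_p\underline{t}^p\in\mathbf{K}[[t_1,\ldots,t_e]]$ with $f(t_1^n,\ldots,t_e^n,y(\underline{t}))=0$, and the $n$ roots of $f(t_1^n,\ldots,t_e^n,y)=0$ are of the form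 $y(w_1t_1,\ldots,w_et_e)$ with $w_1,\ldots,w_e$ $n$-th roots of unity in $\mathbf{K}$. Characteristic exponents. There is a finite sequence $m_1,\ldots,m_h$ of elements of $\mathrm{Supp}(f)=\{p: c_p\ne0\}$ (the characteristic exponents of $f$) such that: $m_1<m_2<\cdots<m_h$ coordinate-wise ($a<b$ means $a\le b$ in each coordinate and $a\neq b$); if $c_p\neq0$ then $p\in(n\mathbf{Z})^e+\sum_{|m_i|\le|p|}m_i\mathbf{Z}$ (where $|p|$ is the sum of the coordinates of $p$); and $m_i\notin(n\mathbf{Z})^e+\sum_{j<i}m_j\mathbf{Z}$ for all $i$. gcd-sequence. $D_1=n^e$, and for $1\le i\le h$, $D_{i+1}$ is the gcd of the $e\times e$ minors of the $e\times(e+i)$ matrix $(nI_e,m_1^T,\ldots,m_i^T)$. One has $D_{h+1}=n^{e-1}$; put $d_i=D_i/D_{h+1}$, so $d_1=n$ and $d_{h+1}=1$. Order and semigroup. For nonzero $u\in\mathbf{K}[[\underline{t}]]$, $\mathrm{In}(u)$ is the nonzero homogeneous component of $u$ of smallest total degree, and $\exp(u)$ is the greatest exponent, for the lexicographical order, of a monomial occurring in $\mathrm{In}(u)$. For $g\in\mathbf{R}[y]$ with $g(t_1^n,\ldots,t_e^n,y(\underline{t}))\ne0$, $O(f,g)=\exp\big(g(t_1^n,\ldots,t_e^n,y(\underline{t}))\big)$ (independent of the chosen root $y(\underline{t})$). The semigroup is $\Gamma(f)=\{O(f,g): g\in\mathbf{R}[y],\ g(t_1^n,\ldots,t_e^n,y(\underline{t}))\neq0\}\subseteq\mathbf{Z}^e$.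 Approximate roots. For a divisor $d$ of $n$, the $d$-th approximate root $\mathrm{App}_d(f)$ is the unique monic polynomial $g\in\mathbf{R}[y]$ of degree $n/d$ in $y$ such that $\deg_y(f-g^d)<n-n/d$. *)

(* Defs.v *)
From HB Require Import structures.
From mathcomp Require Import all_boot all_order all_algebra.
From mathcomp Require Import boolp.
From mathcomp Require classical_sets.
From mathcomp Require Import mpoly.

Set Implicit Arguments.
Unset Strict Implicit.
Unset Printing Implicit Defensive.

Import Order.TTheory GRing.Theory.
Local Open Scope ring_scope.

(* Formal power series in e variables: a series is the family of its
   coefficients, indexed by the monomials ['X_{1..e}], i.e. by N^e. *)

Record mps (e : nat) (K : Type) := Mps { mpscoef :> 'X_{1..e} -> K }.

HB.instance Definition _ e K := [isNew for @mpscoef e K].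
HB.instance Definition _ e (K : choiceType) := [Choice of mps e K by <:].

Section MpsRing.
Context (e : nat) (K : comNzRingType).
Implicit Types (a b c : mps e K) (m : 'X_{1..e}).

Lemma mpsP a b : (forall m, a m = b m) <-> a = b.
Proof.
split=> [eq_ab|-> //]; case: a b eq_ab => [a] [b] /= eq_ab.
by congr Mps; apply/funext.
Qed.

Definition mps0 : mps e K := Mps (fun=> 0).
Definition mps_opp a : mps e K := Mps (fun m => - a m).
Definition mps_add a b : mps e K := Mps (fun m => a m + b m).
(* the monomial x^N *)
Definition mpsX (N : 'X_{1..e}) : mps e K := Mps (fun m => (m == N)%:R).
(* Cauchy product; the degree bound only serves to make the index type finite *)
Definition mps_mul a b : mps e K := Mps (fun m =>
  \sum_(k : 'X_{1..e < (mdeg m).+1, (mdeg m).+1} | m == (k.1 + k.2)%MM)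
     a k.1 * b k.2).

Lemma mps_addA : associative mps_add.
Proof. by move=> a b c; apply/mpsP=> m /=; rewrite addrA. Qed.
Lemma mps_addC : commutative mps_add.
Proof. by move=> a b; apply/mpsP=> m /=; rewrite addrC. Qed.
Lemma mps_add0 : left_id mps0 mps_add.
Proof. by move=> a; apply/mpsP=> m /=; rewrite add0r. Qed.
Lemma mps_addN : left_inverse mps0 mps_opp mps_add.
Proof. by move=> a; apply/mpsP=> m /=; rewrite addNr. Qed.

HB.instance Definition _ := GRing.isZmodule.Build (mps e K)
  mps_addA mps_addC mps_add0 mps_addN.

(* The ring laws are obtained from those of polynomials by truncation. *)
Definition mps_trunc (k : nat) a : {mpoly K[e]} :=
  \sum_(m : 'X_{1..e < k}) a m *: 'X_[m].

Lemma mps_truncE k a m : (mdeg m < k)%N -> (mps_trunc k a)@_m = a m.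
Proof.
move=> lt_mk; rewrite /mps_trunc raddf_sum /= (bigD1 (BMultinom lt_mk)) //=.
rewrite mcoeffZ mcoeffX eqxx mulr1 big1 ?addr0 // => i.
by rewrite bmeqP mcoeffZ mcoeffX /= => /negPf ->; rewrite mulr0.
Qed.

Lemma mps_mul_trunc k a b m : (mdeg m < k)%N ->
  mps_mul a b m = (mps_trunc k a * mps_trunc k b)@_m.
Proof.
move=> lt_mk; rewrite mcoeffM /=; apply: eq_bigr => -[i j] _ /=.
by rewrite !mps_truncE //; apply: leq_trans lt_mk; rewrite ?bmdeg.
Qed.

Lemma mps_trunc_mul k a b m : (mdeg m < k)%N ->
  (mps_trunc k (mps_mul a b))@_m = (mps_trunc k a * mps_trunc k b)@_m.
Proof. by move=> ltmk; rewrite mps_truncE // (@mps_mul_trunc k). Qed.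

Lemma mps_mulA : associative mps_mul.
Proof.
move=> a b c; apply/mpsP=> m; have lt := ltnSn (mdeg m).
rewrite !(mps_mul_trunc _ _ lt).
have lem (p : 'X_{1..e < (mdeg m).+1}) x y :
    (mps_trunc (mdeg m).+1 (mps_mul x y))@_p
  = (mps_trunc (mdeg m).+1 x * mps_trunc (mdeg m).+1 y)@_p.
  by rewrite mps_trunc_mul ?bmdeg.
transitivity ((mps_trunc (mdeg m).+1 a * (mps_trunc (mdeg m).+1 b
                * mps_trunc (mdeg m).+1 c))@_m).
  by rewrite !(mcoeffM (mps_trunc _ a)); apply: eq_bigr => -[i j] _ /=; rewrite lem.
by rewrite mulrA !(mcoeffM _ (mps_trunc _ c)); apply: eq_bigr => -[i j] _ /=;
   rewrite lem.
Qed.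

Lemma mps_mulC : commutative mps_mul.
Proof.
move=> a b; apply/mpsP=> m; have lt := ltnSn (mdeg m).
by rewrite !(mps_mul_trunc _ _ lt) mulrC.
Qed.

Lemma mps_trunc1 k : (0 < k)%N -> mps_trunc k (mpsX 0) = 1.
Proof.
move=> k0; apply/mpolyP=> m; rewrite mcoeff1.
have [lt|le] := ltnP (mdeg m) k; first by rewrite mps_truncE //= .
have /negPf-> : m != 0%MM.
  by rewrite -mdeg_eq0 -lt0n (leq_trans k0).
rewrite /mps_trunc raddf_sum big1 //= => i _; rewrite mcoeffZ mcoeffX.
case: (eqVneq (bmnm i) m) => [im|_]; last by rewrite mulr0.
by move: le; rewrite -im leqNgt bmdeg.
Qed.

Lemma mps_mul1 : left_id (mpsX 0) mps_mul.
Proof.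
move=> a; apply/mpsP=> m; have lt := ltnSn (mdeg m).
by rewrite (mps_mul_trunc _ _ lt) mps_trunc1 // mul1r mps_truncE.
Qed.

Lemma mps_mulDl : left_distributive mps_mul mps_add.
Proof.
move=> a b c; apply/mpsP=> m /=; rewrite -big_split /=.
by apply: eq_bigr => k _; rewrite mulrDl.
Qed.

Lemma mps1_neq0 : mpsX 0 != mps0.
Proof.
apply/eqP => /mpsP /(_ 0%MM) /=; rewrite eqxx => /eqP.
by rewrite oner_eq0.
Qed.

HB.instance Definition _ := GRing.Zmodule_isComNzRing.Build (mps e K)
  mps_mulA mps_mulC mps_mul1 mps_mulDl mps1_neq0.

Definition mps_unit : pred (mps e K) := fun a => `[< exists b, b * a = 1 >].
Definition mps_inv a : mps e K :=
  if a \in mps_unit then classical_sets.xget a (fun b => b * a = 1) else a.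

Lemma mps_mulVr : {in mps_unit, left_inverse 1 mps_inv *%R}.
Proof.
move=> a ua; rewrite /mps_inv ua; case: classical_sets.xgetP => [b _ //|noinv].
by move: ua; rewrite unfold_in => /asboolP[b /noinv].
Qed.

Lemma mps_unitPl a b : b * a = 1 -> a \in mps_unit.
Proof. by move=> ba1; rewrite unfold_in; apply/asboolP; exists b. Qed.

Lemma mps_inv_out : {in [predC mps_unit], mps_inv =1 id}.
Proof. by move=> a /negPf; rewrite /mps_inv => ->. Qed.

HB.instance Definition _ := GRing.ComNzRing_hasMulInverse.Build (mps e K)
  mps_mulVr mps_unitPl mps_inv_out.

End MpsRing.

Section MpsIdomain.
Context (e : nat) (K : idomainType).

Lemma mps_low (a : mps e K) : a != 0 ->
  exists m, a m != 0 /\ forall k, (k < m)%O -> a k = 0.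
Proof.
move=> a0; have [m am] : exists m, a m != 0.
  apply: contrapT => /forallNP z; case/eqP: a0; apply/mpsP => m /=.
  by apply/eqP/negPn/negP/z.
move: m am; apply: ltmwf => m IH am.
have [ex|nex] := pselect (exists2 k, (k < m)%O & a k != 0).
  by case: ex => k km ak; apply: IH ak.
exists m; split=> // k km; apply/eqP/negPn/negP => ak.
by apply: nex; exists k.
Qed.

Lemma mps_idomain_axiom : GRing.integral_domain_axiom (mps e K).
Proof.
move=> a b ab0; have [//|a0] := eqVneq a 0; have [//|b0] /= := eqVneq b 0.
have [p [ap pmin]] := mps_low a0; have [q [bq qmin]] := mps_low b0.
have aux x y : (p + q = x + y)%MM -> (x != p) || (y != q) -> a x * b y = 0.
  move=> eq neq.
  have [xp|px|xp] := ltgtP x p; first by rewrite pmin ?mul0r.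
  - have [yq|qy|yq] := ltgtP y q; first by rewrite qmin ?mulr0.
    + by have := ltm_add px qy; rewrite eq ltxx.
    + by move: px; rewrite -(ltmc_add2l _ _ q) eq yq ltxx.
  - by move: eq neq; rewrite xp => /addmI <-; rewrite !eqxx.
have pP : (mdeg p < (mdeg (p + q)%MM).+1)%N by rewrite mdegD ltnS leq_addr.
have qP : (mdeg q < (mdeg (p + q)%MM).+1)%N by rewrite mdegD ltnS leq_addl.
have := (mpsP (a * b) 0).2 ab0 (p + q)%MM.
rewrite [LHS](bigD1 (BMultinom pP, BMultinom qP)) //= big1 => [|[i j]].
  by rewrite addr0 => /eqP; rewrite mulf_eq0 (negPf ap) (negPf bq).
by case/andP=> /= /eqP eq; rewrite xpair_eqE !bmeqP negb_and; apply: aux.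
Qed.

HB.instance Definition _ :=
  GRing.ComUnitRing_isIntegral.Build (mps e K) mps_idomain_axiom.

End MpsIdomain.

Section Exponent.
Context (e : nat) (K : nmodType).
Implicit Types (u : mps e K) (a b m : 'X_{1..e}).

(* lexicographical order on N^e, the first coordinate being the heaviest *)
Definition lex_lt a b : Prop :=
  exists2 i : 'I_e, (forall j : 'I_e, (j < i)%N -> a j = b j) & (a i < b i)%N.
Definition lex_le a b : Prop := a = b \/ lex_lt a b.

Definition is_mps_ord u (d : nat) : Prop :=
  (exists2 m, u m != 0 & mdeg m = d) /\
  (forall m, u m != 0 -> (d <= mdeg m)%N).
Definition mps_ord u : nat := classical_sets.xget 0%N (is_mps_ord u).

Definition mps_In u : mps e K :=
  Mps (fun m => if mdeg m == mps_ord u then u m else 0).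

Definition is_mps_exp u a : Prop :=
  mps_In u a != 0 /\ forall b, mps_In u b != 0 -> lex_le b a.

(* [mps_exp 0] has no meaning (its value is the default 0). *)
Definition mps_exp u : 'X_{1..e} := classical_sets.xget 0%MM (is_mps_exp u).

End Exponent.

Definition irreducible_elt (A : unitRingType) (a : A) : Prop :=
  [/\ a != 0, a \isn't a GRing.unit &
      forall b c, a = b * c -> b \is a GRing.unit \/ c \is a GRing.unit].

(* The discriminant of a monic polynomial (in characteristic 0, so that
   [f^`()] has its expected degree). *)
Definition discr (A : nzRingType) (f : {poly A}) : A :=
  (-1) ^+ 'C((size f).-1, 2) * resultant f f^`().

Section QuasiOrdinary.
Context (e : nat) (K : idomainType).
Local Notation R := (mps e K).

Definition quasi_ordinary (f : {poly R}) : Prop :=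
  exists (N : 'X_{1..e}) (u : R),
    u \is a GRing.unit /\ discr f = mpsX K N * u.

(* a(x_1, .., x_e) |-> a(t_1^n, .., t_e^n), for n > 0 *)
Definition mps_pow (n : nat) (a : R) : R :=
  Mps (fun m => if [forall i, n %| m i]%N
                then a [multinom (m i %/ n)%N | i < e] else 0).

(* g(t_1^n, .., t_e^n, y(t)) *)
Definition eval_root (n : nat) (y : R) (g : {poly R}) : R :=
  (map_poly (mps_pow n) g).[y].

(* O(f, g), where n = deg f and y is a root of f(t_1^n, .., t_e^n, _) *)
Definition qo_order (n : nat) (y : R) (g : {poly R}) : 'X_{1..e} :=
  mps_exp (eval_root n y g).

(* Gamma(f), where n = deg f and y is a root of f(t_1^n, .., t_e^n, _) *)
Definition qo_semigroup (n : nat) (y : R) (a : 'X_{1..e}) : Prop :=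
  exists2 g : {poly R}, eval_root n y g != 0 & a = qo_order n y g.

End QuasiOrdinary.

(* A sequence m_1, .., m_h is a function [m] on ['I_h]: m_(i+1) is [m i]. *)

Section CharExponents.
Context (e n h : nat) (m : 'I_h -> 'X_{1..e}).

(* p belongs to (n Z)^e + \sum_(j | P j) m_j Z *)
Definition in_lattice (P : pred 'I_h) (p : 'X_{1..e}) : Prop :=
  exists (a : 'I_e -> int) (z : 'I_h -> int), forall l : 'I_e,
    (p l)%:Z = n%:Z * a l + \sum_(j | P j) z j * (m j l)%:Z.

(* [(a < b)%MM] means a <= b in each coordinate and a != b. *)
Definition char_exponents (K : nmodType) (y : mps e K) : Prop :=
  [/\ forall i : 'I_h, y (m i) != 0,
      forall i j : 'I_h, (i < j)%N -> (m i < m j)%MM,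
      forall p, y p != 0 -> in_lattice [pred i : 'I_h | mdeg (m i) <= mdeg p]%N p &
      forall i : 'I_h, ~ in_lattice [pred j : 'I_h | j < i]%N (m i)].

(* the matrix (n I_e, m_1^T, .., m_i^T) *)
Definition char_mx (i : 'I_h.+1) : 'M[int]_(e, e + i) :=
  row_mx (n%:Z)%:M
         (\matrix_(l < e, j < i) (m (widen_ord (leq_ord i) j) l)%:Z).

(* [char_gcd i] is D_(i+1): the gcd of the maximal minors of [char_mx i], which
   are indexed by the increasing choices of e columns. *)
Definition char_gcd (i : 'I_h.+1) : nat :=
  \big[gcdn/0%N]_(s : {ffun 'I_e -> 'I_(e + i)}
                  | [forall a : 'I_e, forall b : 'I_e, (a < b)%N ==> (s a < s b)%N])
     `|\det (colsub s (char_mx i))|%N.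

(* [gcd_seq i] is d_(i+1) = D_(i+1) / D_(h+1) *)
Definition gcd_seq (i : 'I_h.+1) : nat := (char_gcd i %/ char_gcd ord_max)%N.

End CharExponents.

Section ApproxRoot.
Context (A : nzRingType).

(* For f monic of degree n and d dividing n: g is monic of degree n/d, and
   deg (f - g^d) < n - n/d, i.e. [size (f - g ^+ d) <= n - n/d]. *)
Definition is_approx_root (d : nat) (f g : {poly A}) : Prop :=
  let n := (size f).-1 in
  [/\ g \is monic, size g = (n %/ d).+1
    & (size (f - g ^+ d)%R <= n - n %/ d)%N].

(* App_d(f), unique when d is invertible in A *)
Definition approx_root (d : nat) (f : {poly A}) : {poly A} :=
  classical_sets.xget 0 (is_approx_root d f).

End ApproxRoot.

(* Main.v *)
Require Import Defs.
From HB Require Import structures.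
From mathcomp Require Import all_boot all_order all_algebra.
From mathcomp Require Import fingroup perm cyclic separable cyclotomic boolp.
From mathcomp Require classical_sets.
From mathcomp Require Import mpoly.

Set Implicit Arguments.
Unset Strict Implicit.
Unset Printing Implicit Defensive.

Import Order.TTheory GRing.Theory.
Local Open Scope ring_scope.

(** Let [y] be the given root, and let the group of [e]-tuples [w] of [n]-th roots
    of unity act on [K[[t]]] by [t |-> w t]. The distinct conjugates [act w y] are
    the roots of an invariant polynomial, which therefore comes from [R[Y]];
    as [f] is irreducible, it is [f] (lemma [f_conj_poly]). Number the
    characteristic exponents from [0], and let [W k] be the group of the [w] that
    fix the monomials of the first [k] of them. Its order is the gcd of the
    maximal minors attached to these exponents ([char_gcd_card], by the Smith normal
    form), so that the gcd-sequence is [d k = #|W k| / #|W h|]. That [f] is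
    quasi-ordinary means that [y - act w y] divides a monomial times a unit;
    hence it is itself a monomial times a unit, and for [w] in [W j] but not in
    [W j.+1] the monomial has to be the [j]-th characteristic exponent
    ([conj_diff_supp]).

    Let [trunc k] be the part of [y] fixed by [W k], and substitute
    [trunc k + t^m Z] for the variable of a polynomial, where [m] is the [k]-th
    characteristic exponent and [Z] is a new variable. With respect to the order
    that defines [exp], the result starts with a term [t^p A(Z)], its leading form;
    leading forms are multiplicative ([leadM]). The minimal polynomial of
    [trunc k], of degree [N k = n / d k], has a leading form [c t^r Z]
    ([rexpP]), and this [r] is the [k]-th generator. A polynomial of degree less
    than [N k] has a leading form without [Z], whose exponent is generated by the
    multiples of [n] and the previous generators ([const_leadP]). For the step from
    [k] to [k.+1], expand the polynomial in powers of the minimal polynomial of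
    [trunc k]: the terms start with distinct powers of [Z], hence do not
    cancel, and their exponents are distinct because [N k.+1 / N k] is the
    order of the [k]-th characteristic exponent modulo the previous ones.
    At [k = h] this describes the orders of all polynomials of degree less than
    [n], hence, after division by [f], the whole semigroup.

    It remains to see that the approximate root has the same leading form as
    the minimal polynomial of [trunc k]. It is obtained from that polynomial
    by Tschirnhausen steps [g |-> g + q / d], where [q] is the coefficient of
    [g^(d-1)] in the [g]-adic expansion of [f]. The leading form of [f] is
    equivariant under [W k] ([lead_equivariant]), which prevents it from
    containing both [Z^d] and [Z^(d-1)]; since it does contain [Z^d], the
    correction [q] starts after [t^r] and does not change the leading form
    ([semiroot_tschirnhausen]). *)

(** * Coefficients of power series *)

Section SeriesCoef.
Context (e : nat) (K : comNzRingType).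
Implicit Types (a b : mps e K) (p s : 'X_{1..e}).

Lemma mps_sumE (I : Type) (r : seq I) (P : pred I) (F : I -> mps e K) p :
  (\sum_(i <- r | P i) F i) p = \sum_(i <- r | P i) F i p.
Proof. exact: (big_morph (fun a : mps e K => a p)). Qed.

Lemma mps1E p : (1 : mps e K) p = (p == 0%MM)%:R.
Proof. by []. Qed.

(** The defining sum of the product runs over bounded pairs of exponents; a single
    index in an arbitrary list containing the divisors is easier to reindex. *)
Lemma mpsM_seq a b p (r : seq 'X_{1..e}) :
    uniq r -> (forall i, (i <= p)%MM -> i \in r) ->
  (a * b) p = \sum_(i <- r | (i <= p)%MM) a i * b (p - i)%MM.
Proof.
move=> Ur rP; rewrite -[RHS]big_filter.
pose T := ('X_{1..e < (mdeg p).+1, (mdeg p).+1} : Type).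
pose s := [seq k : T <- index_enum _ | p == (k.1 + k.2)%MM].
have aux (x y z : 'X_{1..e}) : x = (y + z)%MM -> (x - y)%MM = z.
  by move=> ->; rewrite addmC addmK.
transitivity (\sum_(k <- s) a (bmnm (fst (k : T))) * b (bmnm (snd (k : T)))); first by rewrite big_filter.
transitivity (\sum_(i <- [seq bmnm (fst (k : T)) | k <- s]) a i * b (p - i)%MM).
  rewrite big_map /s !big_filter; apply: eq_bigr => k /eqP pk.
  by rewrite (aux _ _ _ pk).
apply: perm_big; apply: uniq_perm; rewrite ?filter_uniq //.
  rewrite map_inj_in_uniq ?filter_uniq ?index_enum_uniq //.
  move=> [k1 k2] [l1 l2]; rewrite !mem_filter /=.
  move=> /andP[/eqP pk _] /andP[/eqP pl _] E.
  have E' : bmnm k2 = bmnm l2 by rewrite -(aux _ _ _ pk) -(aux _ _ _ pl) E.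
  by congr pair; apply: val_inj.
move=> i; rewrite mem_filter; apply/mapP/andP => [[k]|[ip _]].
  rewrite mem_filter => /andP[/eqP pk _] ->.
  have kp : (k.1 <= p)%MM by move: (lem_addr k.1 k.2); rewrite -pk.
  by split=> //; apply: rP.
have lt1 : (mdeg i < (mdeg p).+1)%N.
  by rewrite -(submK ip) mdegD ltnS leq_addl.
have lt2 : (mdeg (p - i)%MM < (mdeg p).+1)%N by rewrite ltnS mdegB.
exists (BMultinom lt1, BMultinom lt2) => //.
by rewrite mem_filter mem_index_enum andbT /= addmC submK.
Qed.

Definition below p : seq 'X_{1..e} :=
  [seq bmnm i | i <- enum {: 'X_{1..e < (mdeg p).+1}}].

Lemma below_uniq p : uniq (below p).
Proof. by rewrite map_inj_uniq ?enum_uniq //; apply: val_inj. Qed.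

Lemma mem_below p i : (i \in below p) = (mdeg i <= mdeg p)%N.
Proof.
apply/mapP/idP => [[j _ ->]|le]; first by rewrite -ltnS bmdeg.
rewrite -ltnS in le.
by exists (BMultinom le); rewrite ?mem_enum.
Qed.

Lemma lem_mdeg p i : (i <= p)%MM -> (mdeg i <= mdeg p)%N.
Proof. by move=> ip; rewrite -(submK ip) mdegD leq_addl. Qed.

Lemma mpsME a b p :
  (a * b) p = \sum_(i <- below p | (i <= p)%MM) a i * b (p - i)%MM.
Proof.
apply: mpsM_seq; first exact: below_uniq.
by move=> i /lem_mdeg; rewrite mem_below.
Qed.

Lemma mpsX_mulE s a p :
  (mpsX K s * a) p = if (s <= p)%MM then a (p - s)%MM else 0.
Proof.
rewrite mpsME; case: ifP => sp.
  rewrite big_mkcond (bigD1_seq s) ?below_uniq ?mem_below ?lem_mdeg //=.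
  rewrite sp eqxx mul1r big1 ?addr0 // => i /negPf is_.
  by rewrite is_ mul0r if_same.
rewrite big1_seq // => i /andP[ip _] /=.
by case: eqVneq ip sp => [-> ->|_]; rewrite ?mul0r.
Qed.

Lemma mpsXD s p : mpsX K (s + p)%MM = mpsX K s * mpsX K p.
Proof.
apply/mpsP => q; rewrite mpsX_mulE /=; case: ifP => sq.
  by rewrite -{1}(submK sq) [(s + p)%MM]addmC eqm_add2r.
by case: eqVneq sq => // ->; rewrite lem_addr.
Qed.

Lemma mpsX_neq0 s : mpsX K s != 0.
Proof. by apply/eqP => /mpsP /(_ s) /eqP; rewrite /= eqxx oner_eq0. Qed.

(** A series all of whose exponents are above [s] is a multiple of [t^s]. *)
Lemma mpsX_divides a s :
  (forall p, a p != 0 -> (s <= p)%MM) ->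
  a = mpsX K s * Mps (fun p => a (p + s)%MM).
Proof.
move=> sa; apply/mpsP => p; rewrite mpsX_mulE /=.
case: ifP => sp; first by rewrite submK.
by apply/eqP; apply: contraFT sp => /sa.
Qed.

Definition cmps (c : K) : mps e K := Mps (fun p => if p == 0%MM then c else 0).

Lemma cmps_mulE c a p : (cmps c * a) p = c * a p.
Proof.
rewrite mpsME big_mkcond (bigD1_seq 0%MM) ?below_uniq ?mem_below ?mdeg0 //=.
rewrite eqxx subm0 big1 ?addr0 => [|i /negPf ->].
  by case: mnm_lepP => // -[] i; rewrite mnmE.
by rewrite mul0r if_same.
Qed.

Lemma cmpsM c d : cmps (c * d) = cmps c * cmps d.
Proof.
by apply/mpsP => p; rewrite cmps_mulE /=; case: ifP; rewrite ?mulr0.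
Qed.

Lemma cmps1 : cmps 1 = 1.
Proof. by apply/mpsP => p; rewrite mps1E /=; case: eqP. Qed.

Lemma cmps_nat k : cmps k%:R = k%:R.
Proof.
elim: k => [|k IH]; first by apply/mpsP => p /=; case: ifP.
rewrite [in RHS]mulrS -IH; apply/mpsP => p.
transitivity ((1 : mps e K) p + cmps k%:R p); last by [].
by rewrite mps1E /= [in LHS]mulrS; case: eqP; rewrite ?addr0.
Qed.

End SeriesCoef.

(** * Substitutions in power series *)

Section Substitution.
Context (e : nat) (K : idomainType).
Implicit Types (a b : mps e K).

Section Scaling.
(* [chi] is a character of the monoid of exponents *)
Context (chi : 'X_{1..e} -> K).

Definition rescale a : mps e K := Mps (fun p => chi p * a p).

Lemma rescale_is_zmod : zmod_morphism rescale.
Proof. by move=> a b; apply/mpsP => p /=; rewrite mulrBr. Qed.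

End Scaling.

Lemma rescaleM (chi : 'X_{1..e} -> K) a b :
  (forall p q, chi (p + q)%MM = chi p * chi q) ->
  rescale chi (a * b) = rescale chi a * rescale chi b.
Proof.
move=> chiD; apply/mpsP => p; transitivity (chi p * (a * b) p) => //.
rewrite !mpsME big_distrr /=.
by apply: eq_bigr => i ip; rewrite mulrACA -chiD addmC submK.
Qed.

Lemma mps_pow_is_zmod n : zmod_morphism (@mps_pow e K n).
Proof. by move=> a b; apply/mpsP => p /=; case: ifP; rewrite ?subr0. Qed.

Lemma mps_powE n a p : mps_pow n.+1 a (p *+ n.+1)%MM = a p.
Proof.
rewrite /=; case: forallP => [_|[]]; last by move=> i; rewrite mulmnE dvdn_mull.
by congr (a _); apply/mnmP => i; rewrite mnmE mulmnE mulnK.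
Qed.

Lemma mps_pow_supp n a p :
  mps_pow n.+1 a p != 0 -> exists q, p = (q *+ n.+1)%MM.
Proof.
rewrite /=; case: forallP => [dv _|]; last by rewrite eqxx.
exists [multinom (p i %/ n.+1)%N | i < e].
by apply/mnmP => i; rewrite mulmnE mnmE divnK.
Qed.

Lemma mulmDn (p q : 'X_{1..e}) k : ((p + q) *+ k = p *+ k + q *+ k)%MM.
Proof. by apply/mnmP => i; rewrite !(mulmnE, mnmE) mulnDl. Qed.

Lemma mulmnI n : injective (fun p : 'X_{1..e} => (p *+ n.+1)%MM).
Proof.
move=> p q /mnmP E; apply/mnmP => i; apply/eqP.
by rewrite -(@eqn_pmul2r n.+1) // -!mulmnE E.
Qed.

Lemma lem_mulmn n (p q : 'X_{1..e}) : (p *+ n.+1 <= q *+ n.+1)%MM = (p <= q)%MM.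
Proof. by apply: eq_forallb => i; rewrite !mulmnE leq_pmul2r. Qed.

Lemma mps_powX n (s : 'X_{1..e}) : mps_pow n.+1 (mpsX K s) = mpsX K (s *+ n.+1)%MM.
Proof.
apply/mpsP => p; have [/eqP z|nz] := boolP (mps_pow n.+1 (mpsX K s) p == 0).
  rewrite z /=; case: eqP z => [->|//].
  by rewrite mps_powE /= eqxx => /eqP; rewrite oner_eq0.
have [q ->] := mps_pow_supp nz.
by rewrite mps_powE /= (inj_eq (@mulmnI n)).
Qed.

(** Only the exponents divisible by [n.+1] contribute to the product on the right. *)
Lemma mps_powM n a b :
  mps_pow n.+1 (a * b) = mps_pow n.+1 a * mps_pow n.+1 b.
Proof.
apply/mpsP => p.
have [[q ->]|np] := pselect (exists q, p = (q *+ n.+1)%MM); last first.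
  have z (c : mps e K) : mps_pow n.+1 c p = 0.
    by apply/eqP/negP => /negP nz; apply: np; apply: mps_pow_supp nz.
  rewrite z mpsME big1 // => i ip.
  have [-> |nzi] := eqVneq (mps_pow n.+1 a i) 0; first by rewrite mul0r.
  have [-> |nzj] := eqVneq (mps_pow n.+1 b (p - i)%MM) 0; first by rewrite mulr0.
  have [k ik] := mps_pow_supp nzi; have [j jk] := mps_pow_supp nzj.
  by case: np; exists (j + k)%MM; rewrite mulmDn -ik -jk submK.
rewrite mps_powE [LHS]mpsME.
pose s := below (q *+ n.+1)%MM; pose N := (n.+1).
transitivity (\sum_(i <- [seq (i *+ N)%MM | i <- below q] | (i <= q *+ N)%MM)
   mps_pow N a i * mps_pow N b (q *+ N - i)%MM).
  rewrite [in RHS]big_map; apply: eq_big => [i|i iq]; first by rewrite lem_mulmn.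
  have -> : (q *+ N - i *+ N = (q - i) *+ N)%MM.
    by apply/mnmP => j; rewrite !(mulmnE, mnmE) mulnBl.
  by rewrite !mps_powE.
rewrite [RHS]mpsME.
have drop (r : seq 'X_{1..e}) (Q : pred 'X_{1..e}) (G : 'X_{1..e} -> K) :
    \sum_(i <- r | Q i) mps_pow N a i * G i
    = \sum_(i <- [seq i <- r | Q i && (mps_pow N a i != 0)]) mps_pow N a i * G i.
  rewrite big_filter (bigID (fun i => mps_pow N a i != 0)) /= [X in _ + X]big1.
    by rewrite addr0.
  by move=> i /andP[_]; rewrite negbK => /eqP ->; rewrite mul0r.
rewrite [LHS]drop [RHS]drop.
apply: perm_big; apply: uniq_perm.
- by rewrite filter_uniq // map_inj_uniq ?below_uniq //; apply: mulmnI.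
- by rewrite filter_uniq // below_uniq.
move=> i; rewrite !mem_filter mem_below.
case: (boolP (mps_pow N a i != 0)) => [nz|]; rewrite ?andbF //.
have [k ->] := mps_pow_supp nz; rewrite lem_mulmn.
case kq: (k <= q)%MM => //=; rewrite (mem_map (@mulmnI n)) mem_below lem_mdeg //.
by rewrite !mdegMn leq_mul2r lem_mdeg ?orbT.
Qed.

Lemma mps_pow_is_monoid n : monoid_morphism (@mps_pow e K n.+1).
Proof.
split; last exact: mps_powM.
transitivity (@mpsX e K (0%MM *+ n.+1)%MM); first exact: (mps_powX n 0%MM).
by apply: congr1; apply/mnmP => i; rewrite mulmnE mnmE.
Qed.

HB.instance Definition _ n := GRing.isZmodMorphism.Build (mps e K) (mps e K)
  (@mps_pow e K n.+1) (@mps_pow_is_zmod n.+1).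
HB.instance Definition _ n := GRing.isMonoidMorphism.Build (mps e K) (mps e K)
  (@mps_pow e K n.+1) (@mps_pow_is_monoid n).

Lemma mps_pow_inj n : injective (@mps_pow e K n.+1).
Proof. by move=> a b /mpsP E; apply/mpsP => p; have := E (p *+ n.+1)%MM; rewrite !mps_powE. Qed.

End Substitution.

(** * The order on exponents *)

Section LocalOrder.
Context (e : nat).
Implicit Types (p q r s : 'X_{1..e}).

(** The order for which [mps_exp] is the smallest exponent: smaller degree first
    and, within a degree, lexicographically larger first. *)
Definition mlt p q : bool :=
  (mdeg p < mdeg q)%N || (mdeg p == mdeg q) && (q < p)%O.

Lemma mltxx p : mlt p p = false.
Proof. by rewrite /mlt ltnn ltxx andbF. Qed.

Lemma mlt_trans q p r : mlt p q -> mlt q r -> mlt p r.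
Proof.
rewrite /mlt; case/orP => [lt1|/andP[/eqP -> lt1]].
  by case/orP => [lt2|/andP[/eqP <- _]]; rewrite ?lt1 ?(ltn_trans lt1).
case/orP => [->//|/andP[/eqP -> lt2]].
by rewrite eqxx (lt_trans lt2 lt1) orbT.
Qed.

Lemma mlt0 p : mlt p 0%MM = false.
Proof.
rewrite /mlt mdeg0 ltn0 mdeg_eq0 /=.
by case: eqP => // ->; rewrite ltxx.
Qed.

Lemma mlt_total p q : [\/ mlt p q, p = q | mlt q p].
Proof.
rewrite /mlt; case: (ltngtP (mdeg p) (mdeg q)) => //= _; first by constructor 1.
  by constructor 3.
by case: (ltgtP p q) => [||->]; constructor.
Qed.

Lemma mlt_add2r r p q : mlt (p + r)%MM (q + r)%MM = mlt p q.
Proof. by rewrite /mlt !mdegD ltn_add2r eqn_add2r ltmc_add2l. Qed.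

Lemma mlt_add2l r p q : mlt (r + p)%MM (r + q)%MM = mlt p q.
Proof. by rewrite ![(r + _)%MM]addmC mlt_add2r. Qed.

Lemma mlt_addS p q k l : ~~ mlt k p -> ~~ mlt l q ->
  (k = p /\ l = q) \/ mlt (p + q)%MM (k + l)%MM.
Proof.
case: (mlt_total p k) => [pk _|<- _|-> //].
  case: (mlt_total q l) => [ql _|<- _|-> //]; right; rewrite ?mlt_add2r //.
  by apply: (@mlt_trans (k + q)%MM); rewrite ?mlt_add2r ?mlt_add2l.
case: (mlt_total q l) => [ql _|<- _|-> //]; last by left.
by right; rewrite mlt_add2l.
Qed.

Lemma lem_mlt p q : (p <= q)%MM -> p = q \/ mlt p q.
Proof.
move=> pq; have := submK pq; set d := (q - p)%MM => <-.
have [->|nz] := eqVneq d 0%MM; first by left; rewrite add0m.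
by right; rewrite /mlt mdegD -{1}[mdeg p]add0n ltn_add2r lt0n mdeg_eq0 nz.
Qed.

Lemma mlt_muln k p q : mlt (p *+ k.+1)%MM (q *+ k.+1)%MM = mlt p q.
Proof.
have H a b : mlt a b -> mlt (a *+ k.+1)%MM (b *+ k.+1)%MM.
  move=> ab; elim: k => [|j IH]; first by rewrite !mulmS mlt_add2r.
  rewrite mulmS [X in mlt _ X]mulmS; apply: (@mlt_trans (a + b *+ j.+1)%MM).
    by rewrite mlt_add2l.
  by rewrite mlt_add2r.
case: (mlt_total p q) => [pq|->|qp]; first by rewrite pq H.
  by rewrite !mltxx.
have -> : mlt p q = false by apply/negP => /mlt_trans/(_ qp); rewrite mltxx.
by apply/negP => /mlt_trans/(_ (H _ _ qp)); rewrite mltxx.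
Qed.

(** There are finitely many exponents of each degree, so the order has minima. *)
Lemma mlt_min (Q : 'X_{1..e} -> Prop) :
  (exists p, Q p) -> exists2 p, Q p & forall q, mlt q p -> ~ Q q.
Proof.
move=> [p0 Qp0].
pose D := [pred d : nat | `[< exists2 p, Q p & mdeg p = d >]].
have exD : exists d, D d by exists (mdeg p0); apply/asboolP; exists p0.
case: (ex_minnP exD) => d /asboolP[p1 Qp1 dp1] dmin.
pose T := 'X_{1..e < d.+1}.
have lt1 : (mdeg p1 < d.+1)%N by rewrite dp1.
pose S := [pred x : T | `[< Q x >] && (mdeg x == d)].
have S1 : S (BMultinom lt1) by rewrite /= dp1 eqxx andbT; apply/asboolP.
case: (@Order.TotalTheory.arg_maxP _ _ T (BMultinom lt1) S
        (fun x => x : 'X_{1..e}) S1) => x /andP[/asboolP Qx /eqP dx] xmax.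
exists (x : 'X_{1..e}) => // q; rewrite /mlt dx => /orP[lt|/andP[/eqP dq lt]] Qq.
  have := dmin (mdeg q); rewrite leqNgt lt => /(_ _)/negP; apply => //.
  by apply/asboolP; exists q.
have ltq : (mdeg q < d.+1)%N by rewrite dq.
have /(_ _)/= := xmax (BMultinom ltq); rewrite /= leNgt lt => /(_ _)/negP; apply => //.
by rewrite dq eqxx andbT; apply/asboolP.
Qed.

End LocalOrder.

(** * Leading forms *)

Section LeadingForm.
Context (e : nat) (K : idomainType).
Local Notation R := (mps e K).
Implicit Types (P Q : {poly R}) (A B : {poly K}) (p q s : 'X_{1..e}).

(** Only the product of the two lowest terms reaches the exponent [p + q]. *)
Lemma mpsM_low (a b : R) p q :
    (forall s, mlt s p -> a s = 0) -> (forall s, mlt s q -> b s = 0) ->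
  (forall s, mlt s (p + q)%MM -> (a * b) s = 0) /\
  (a * b) (p + q)%MM = a p * b q.
Proof.
move=> alow blow.
have aux k l : ~ (k = p /\ l = q) -> ~~ mlt (p + q)%MM (k + l)%MM ->
    a k * b l = 0.
  move=> ne nlt; have [kp|kp] := boolP (mlt k p); first by rewrite alow ?mul0r.
  have [lq|lq] := boolP (mlt l q); first by rewrite blow ?mulr0.
  by case: (mlt_addS kp lq) => // lt; rewrite lt in nlt.
split=> [s lts|].
  rewrite mpsME big1 // => i si; apply: aux.
    by case=> ip /esym qE; move: lts; rewrite -ip qE addmC submK ?mltxx.
  rewrite [(i + _)%MM]addmC submK //; apply/negP => lt.
  by move: (mlt_trans lt lts); rewrite mltxx.
rewrite mpsME big_mkcond.
rewrite (bigD1_seq p) ?below_uniq ?mem_below ?mdegD ?leq_addr //=.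
rewrite lem_addr big1 => [|i ip].
  by rewrite addr0 {1}addmC addmK.
case: ifP => // ile; apply: aux; last by rewrite [(i + _)%MM]addmC submK ?mltxx.
by case=> ip'; rewrite ip' eqxx in ip.
Qed.

(** The expansion of [P] with respect to the monomials of the coefficients
    starts, for the order [mlt], with [t^p A]; [A] may vanish. *)
Definition lead P p A : Prop :=
  forall i, (forall s, mlt s p -> P`_i s = 0) /\ P`_i p = A`_i.

Lemma lead_ext P p A B : lead P p A -> A = B -> lead P p B.
Proof. by move=> l <-. Qed.

Lemma leadC (c : R) p (a : K) :
  (forall s, mlt s p -> c s = 0) -> c p = a -> lead c%:P p a%:P.
Proof.
move=> clow cp i; rewrite !coefC; case: eqP => _ //.
Qed.

Lemma supp_low (a : R) mu :
  (forall p, a p != 0 -> (mu <= p)%MM) -> forall s, mlt s mu -> a s = 0.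
Proof.
move=> H s lt; apply/eqP/negPn/negP => /H/lem_mlt[E|lt'].
  by rewrite E mltxx in lt.
by have := mlt_trans lt lt'; rewrite mltxx.
Qed.

Lemma lead_var : lead 'X 0%MM 'X.
Proof.
move=> i; rewrite !coefX; split=> [s|].
  by case: (i == 1)%N => //; rewrite mps1E; case: eqP => // ->; rewrite mltxx.
by case: (i == 1)%N => //; rewrite mps1E eqxx.
Qed.

Lemma lead0 p : lead 0 p 0.
Proof. by move=> i; rewrite !coef0. Qed.

Lemma leadC0 (c : R) : lead c%:P 0%MM (c 0%MM)%:P.
Proof. by apply: leadC => // s; rewrite mlt0. Qed.

Lemma lead1 : lead 1 0 1.
Proof.
apply: leadC => [s|]; rewrite mps1E ?eqxx //.
by case: eqP => // ->; rewrite mltxx.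
Qed.

Lemma leadD P Q p A B : lead P p A -> lead Q p B -> lead (P + Q) p (A + B).
Proof.
move=> lP lQ i; rewrite !coefD; split=> [s sp|].
  by rewrite -[LHS]/(P`_i s + Q`_i s) (lP i).1 // (lQ i).1 // addr0.
by rewrite -[LHS]/(P`_i p + Q`_i p) (lP i).2 (lQ i).2.
Qed.

Lemma leadN P p A : lead P p A -> lead (- P) p (- A).
Proof.
move=> lP i; rewrite !coefN; split=> [s sp|].
  by rewrite -[LHS]/(- P`_i s) (lP i).1 // oppr0.
by rewrite -[LHS]/(- P`_i p) (lP i).2.
Qed.

Lemma leadB P Q p A B : lead P p A -> lead Q p B -> lead (P - Q) p (A - B).
Proof. by move=> lP /leadN; apply: leadD. Qed.

Lemma lead_sum (I : Type) (r : seq I) (S : pred I) F G p :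
  (forall i, S i -> lead (F i) p (G i)) ->
  lead (\sum_(i <- r | S i) F i) p (\sum_(i <- r | S i) G i).
Proof.
move=> FG; elim/big_rec2: _ => [|i A P Si]; first exact: lead0.
by apply: leadD; apply: FG.
Qed.

Lemma lead_lt P p q A : lead P p A -> mlt q p -> lead P q 0.
Proof.
move=> lP qp i; rewrite coef0; split=> [s sq|]; last exact: (lP i).1.
by apply: (lP i).1; apply: mlt_trans qp.
Qed.

Lemma leadM P Q p q A B :
  lead P p A -> lead Q q B -> lead (P * Q) (p + q)%MM (A * B).
Proof.
move=> lP lQ i; rewrite !coefM.
have H (j : 'I_i.+1) := mpsM_low (lP j).1 (lQ (i - j)%N).1.
split=> [s lts|]; rewrite mps_sumE; first by apply: big1 => j _; rewrite (H j).1.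
by apply: eq_bigr => j _; rewrite (H j).2 (lP j).2 (lQ _).2.
Qed.

Lemma leadX P p A k : lead P p A -> lead (P ^+ k) (p *+ k)%MM (A ^+ k).
Proof.
move=> lP; elim: k => [|k IH]; first exact: lead1.
by rewrite !exprS mulmS; apply: leadM.
Qed.

Lemma leadZ0 (c : R) P q A : lead P q A -> lead (c *: P) q (c 0%MM *: A).
Proof.
move=> lP; rewrite -[q]add0m -!mul_polyC; exact: leadM (leadC0 c) lP.
Qed.

Lemma leadZ (c : R) P p q (a : K) A :
    (forall s, mlt s p -> c s = 0) -> c p = a -> lead P q A ->
  lead (c *: P) (p + q)%MM (a *: A).
Proof. by move=> cl cp lP; rewrite -!mul_polyC; apply: leadM (leadC cl cp) lP. Qed.

Lemma lead_prod (I : Type) (r : seq I) (F : I -> {poly R}) G H :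
  (forall i, lead (F i) (G i) (H i)) ->
  lead (\prod_(i <- r) F i) (\sum_(i <- r) G i)%MM (\prod_(i <- r) H i).
Proof.
move=> FGH; elim: r => [|i r IH]; first by rewrite !big_nil; apply: lead1.
by rewrite !big_cons; apply: leadM.
Qed.

Lemma lead_comp P Q p A B :
  lead P p A -> lead Q 0%MM B -> lead (P \Po Q) p (A \Po B).
Proof.
move=> lP lQ; pose m := maxn (size P) (size A).
have E (T : comNzRingType) (S U : {poly T}) : (size S <= m)%N ->
    S \Po U = \sum_(i < m) (S`_i)%:P * U ^+ i.
  move=> le; rewrite comp_polyE (big_ord_widen m (fun i => S`_i *: U ^+ i)) //.
  rewrite big_mkcond; apply: eq_bigr => i _; rewrite mul_polyC.
  by case: ltnP => // si; rewrite nth_default ?scale0r.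
rewrite !E ?leq_maxl ?leq_maxr //; apply: lead_sum => i _.
rewrite -[p]addm0; apply: leadM; first by apply: leadC; case: (lP i).
have -> : (0 = (0 : 'X_{1..e}) *+ i)%MM.
  by apply/mnmP => j; rewrite mulmnE mnmE.
exact: leadX.
Qed.

Lemma lead_uniq P p q A B :
  lead P p A -> lead P q B -> A != 0 -> B != 0 -> p = q /\ A = B.
Proof.
move=> lA lB A0 B0; have z (C : {poly K}) : (forall i, C`_i = 0) -> C = 0.
  by move=> E; apply/polyP => i; rewrite coef0.
case: (mlt_total p q) => [pq|pq|qp].
- by case/eqP: A0; apply: z => i; rewrite -(lA i).2 (lB i).1.
- by split=> //; apply/polyP => i; rewrite -(lA i).2 pq (lB i).2.
- by case/eqP: B0; apply: z => i; rewrite -(lB i).2 (lA i).1.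
Qed.

Lemma lead_neq0 P p A : lead P p A -> A != 0 -> P != 0.
Proof.
move=> lP; apply: contraNneq => P0; apply/eqP/polyP => i.
by rewrite -(lP i).2 P0 !coef0.
Qed.

Lemma lead_ex P : P != 0 -> exists p A, lead P p A /\ A != 0.
Proof.
move=> P0; have : exists p, exists i, P`_i p != 0.
  apply: contrapT => H; case/eqP: P0; apply/polyP => i; rewrite coef0.
  apply/mpsP => p; apply/eqP; apply: contrapT => /negP nz.
  by apply: H; exists p, i.
case/mlt_min => p [i Pip] pmin.
exists p, (\poly_(j < size P) P`_j p); split=> [j|].
  split=> [s /pmin ns|].
    by apply/eqP; apply: contrapT => /negP nz; apply: ns; exists j.
  by rewrite coef_poly; case: ltnP => // le; rewrite nth_default.
apply/eqP => /polyP/(_ i); rewrite coef0 coef_poly; case: ltnP => [_ /eqP|le _].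
  by rewrite (negPf Pip).
by rewrite nth_default // eqxx in Pip.
Qed.

(** Terms that start with powers [Z^i] of distinct degrees cannot cancel. *)
Lemma lead_sum_distinct m (I : pred 'I_m) (T : 'I_m -> {poly R})
    (p : 'I_m -> 'X_{1..e}) (c : 'I_m -> K) :
    (forall i, ~~ I i -> T i = 0) ->
    (forall i, I i -> lead (T i) (p i) (c i *: 'X^i)) ->
    (exists i, I i) ->
  exists i0, [/\ I i0, forall i, I i -> ~~ mlt (p i) (p i0)
    & lead (\sum_i T i) (p i0) (\sum_(i | I i && (p i == p i0)) c i *: 'X^i)].
Proof.
move=> T0 Tl [j Ij].
have [|q [i0 Ii0 pi0] qmin] := @mlt_min e (fun q => exists2 i, I i & p i = q).
  by exists (p j), j.
exists i0; split=> // [i Ii|].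
  by rewrite pi0; apply/negP => /qmin; apply; exists i.
rewrite (bigID (fun i => I i && (p i == p i0))) /= -[X in lead _ _ X]addr0.
apply: leadD; first by apply: lead_sum => i /andP[Ii /eqP <-]; apply: Tl.
apply: (@lead_ext _ _ (\sum_(i | ~~ (I i && (p i == p i0))) 0)); last first.
  by rewrite big1.
apply: lead_sum => i; have [Ii|nI] /= := boolP (I i); last first.
  by rewrite T0 // => _; apply: lead0.
move=> /eqP ne; apply: lead_lt (Tl i Ii) _; rewrite pi0.
case: (mlt_total (p i) q) => [/qmin|E|//]; last by rewrite E pi0 in ne.
by case; exists i.
Qed.

Lemma coef_sum_monom m (J : pred 'I_m) (c : 'I_m -> K) (i : 'I_m) :
  (\sum_(j | J j) c j *: 'X^j : {poly K})`_i = if J i then c i else 0.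
Proof.
rewrite coef_sum big_mkcond (bigD1 i) //= coefZ coefXn eqxx mulr1.
rewrite big1 ?addr0 // => j ji; rewrite coefZ coefXn eq_sym.
by rewrite (inj_eq val_inj) (negPf ji) mulr0 if_same.
Qed.

End LeadingForm.

Section ExponentOfLead.
Context (e : nat) (K : idomainType).

(** On a given degree the order of the monomials of the library is the
    lexicographical order, so [mps_exp] is the minimum for [mlt]. *)
Lemma mps_expE (u : mps e K) p :
  (forall s, mlt s p -> u s = 0) -> u p != 0 -> mps_exp u = p.
Proof.
move=> ulow up.
have ordE : mps_ord u = mdeg p.
  have ho : is_mps_ord u (mdeg p).
    split; first by exists p.
    move=> s us; rewrite leqNgt; apply: contra us => lt.
    by rewrite ulow // /mlt lt.
  rewrite /mps_ord; apply: classical_sets.xget_unique => // d [[s us <-] dmin].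
  by apply/eqP; rewrite eqn_leq dmin //= (ho.2 _ us).
have InE s : (mps_In u s != 0) = (u s != 0) && (mdeg s == mdeg p).
  by rewrite /= ordE; case: (mdeg s == _); rewrite ?andbT ?eqxx ?andbF.
have lexP a b : lex_le a b -> mdeg a = mdeg b -> (a <= b)%O.
  by case=> [->|lt] dE //; apply/ltW/(ltmcP dE).
have he : is_mps_exp u p.
  split; first by rewrite InE up eqxx.
  move=> b; rewrite InE => /andP[ub /eqP db].
  case: (ltgtP b p) => [lt|lt|-> //]; last by left.
    by right; apply/ltmcP.
  by rewrite ulow ?eqxx // /mlt db eqxx lt orbT in ub.
rewrite /mps_exp; apply: classical_sets.xget_unique => // a [ua amax].
have [_ da] := andP (etrans (esym (InE a)) ua).
apply/eqP; rewrite eq_le; apply/andP; split.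
  by apply: lexP (eqP da); apply: he.2.
by apply: lexP (esym (eqP da)); apply: amax; rewrite InE up eqxx.
Qed.

Lemma lead_const_exp (u : mps e K) p c :
  c != 0 -> lead u%:P p c%:P -> u != 0 /\ mps_exp u = p.
Proof.
move=> c0 l; have := l 0%N; rewrite !coefC /= => -[ulow up].
split; last by apply: mps_expE; rewrite ?up.
by apply: contraNneq c0 => u0; rewrite -up u0.
Qed.

End ExponentOfLead.

(** * The torsion group and its action *)

Section TorsionGroup.
Context (e n : nat).
Implicit Types (p q : 'X_{1..e}).

(** The element [w] stands for the tuple of the roots of unity [om ^ (w i)], where
    [om] is a primitive root of order [n.+1]. *)
Definition torsion : Type := {ffun 'I_e -> 'I_n.+1}.
HB.instance Definition _ := GRing.Zmodule.on torsion.
HB.instance Definition _ := Finite.on torsion.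
Implicit Types (v w : torsion).

Definition pairing w p : 'I_n.+1 := \sum_i w i *+ p i.

Lemma pairingDl v w p : pairing (v + w) p = pairing v p + pairing w p.
Proof.
by rewrite -big_split /=; apply: eq_bigr => i _; rewrite ffunE mulrnDl.
Qed.

Lemma pairingNl w p : pairing (- w) p = - pairing w p.
Proof.
rewrite [RHS](big_morph _ (@opprD _) (oppr0 _)).
by apply: eq_bigr => i _; rewrite ffunE mulNrn.
Qed.

Lemma pairing0l p : pairing 0 p = 0.
Proof. by apply: big1 => i _; rewrite ffunE mul0rn. Qed.

Lemma pairingDr w p q : pairing w (p + q)%MM = pairing w p + pairing w q.
Proof.
by rewrite -big_split /=; apply: eq_bigr => i _; rewrite mnmDE mulrnDr.
Qed.

Lemma pairing0r w : pairing w 0%MM = 0.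
Proof. by apply: big1 => i _; rewrite mnmE. Qed.

Lemma pairingMn w p k : pairing w (p *+ k)%MM = pairing w p *+ k.
Proof.
by elim: k => [|k IH]; rewrite ?pairing0r // mulmS pairingDr IH mulrS.
Qed.

Lemma ord_mulrn_val (x : 'I_n.+1) k : x *+ k = (x * k %% n.+1)%N :> nat.
Proof.
elim: k => [|k IH]; first by rewrite muln0 mod0n.
by rewrite mulrS /= IH mulnS modnDmr.
Qed.

Lemma ord_mulrn_eq0 (x : 'I_n.+1) k : (x *+ k == 0) = (n.+1 %| x * k)%N.
Proof. by rewrite -val_eqE /= ord_mulrn_val. Qed.

Lemma pairing_mul w p : pairing w (p *+ n.+1)%MM = 0.
Proof. by rewrite pairingMn; apply/eqP; rewrite ord_mulrn_eq0 dvdn_mull. Qed.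

Lemma pairing_all0 p : (forall w, pairing w p = 0) ->
  exists q, p = (q *+ n.+1)%MM.
Proof.
move=> H; exists [multinom (p i %/ n.+1)%N | i < e].
apply/mnmP => i; rewrite mulmnE mnmE divnK //.
pose w : torsion := [ffun j => if j == i then inord 1 else 0].
have := H w; rewrite /pairing (bigD1 i) //= big1 => [|j ji]; last first.
  by rewrite ffunE (negPf ji) mul0rn.
rewrite addr0 ffunE eqxx => /eqP; rewrite ord_mulrn_eq0.
(* for [n = 0] the type ['I_1] has no element 1, but everything is divisible *)
case: (n) => [|k]; first by rewrite dvd1n.
by rewrite inordK // mul1n.
Qed.

Definition subtorsion (A : {set torsion}) : Prop :=
  0 \in A /\ {in A &, forall v w, v - w \in A}.

(** If [phi] separates two elements of [A] exactly when they differ modulo [B], its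
    fibres on [A] are translates of [B]. *)

Section Fibres.
Context (S : eqType) (A B : {set torsion}) (phi : torsion -> S).
Hypothesis subA : subtorsion A.
Hypothesis subBA : B \subset A.
Hypothesis phiP : {in A &, forall v w, (phi v == phi w) = (v - w \in B)}.

Lemma count_fibre s : s \in [seq phi w | w <- enum A] ->
  count_mem s [seq phi w | w <- enum A] = #|B|.
Proof.
case/mapP => w0; rewrite mem_enum => Aw0 ->.
rewrite count_map -size_filter.
have /perm_size -> : perm_eq [seq x <- enum A | preim phi (pred1 (phi w0)) x]
    [seq b + w0 | b <- enum B].
  apply: uniq_perm; first exact: filter_uniq (enum_uniq _).
    by rewrite map_inj_uniq ?enum_uniq //; apply: addIr.
  move=> x; rewrite mem_filter mem_enum /=; apply/andP/mapP.
    case=> E Ax; exists (x - w0); last by rewrite subrK.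
    by rewrite mem_enum -phiP.
  case=> b; rewrite mem_enum => Bb ->.
  have Ab := subsetP subBA _ Bb.
  have A1 : b + w0 \in A.
    rewrite -[w0]opprK; apply: subA.2 => //; rewrite -[- w0]add0r.
    by apply: subA.2 => //; exact: subA.1.
  by split=> //; rewrite phiP // addrK.
by rewrite size_map cardE.
Qed.

Lemma card_fibres : #|A| = (size (undup [seq phi w | w <- enum A]) * #|B|)%N.
Proof.
transitivity (size [seq phi w | w <- enum A]); first by rewrite size_map cardE.
rewrite -sum1_size -big_undup_iterop_count /= big_seq_cond.
rewrite (eq_bigr (fun=> #|B|)) => [|s]; last first.
  by rewrite andbT mem_undup => /count_fibre ->; elim: #|B| => // k; rewrite !Monoid.iteropE /= => ->.
by rewrite -big_seq_cond big_const_seq count_predT iter_addn_0 mulnC.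
Qed.

Lemma prod_fibres (R : comNzRingType) (F : S -> R) :
  \prod_(w in A) F (phi w)
  = (\prod_(s <- undup [seq phi w | w <- enum A]) F s) ^+ #|B|.
Proof.
rewrite -[LHS]big_enum /= -(big_map phi predT) -big_undup_iterop_count /=.
rewrite -prodrXl big_seq [RHS]big_seq; apply: eq_bigr => s.
by rewrite mem_undup => /count_fibre ->.
Qed.

End Fibres.

Context (K : idomainType) (om : K) (om_prim : n.+1.-primitive_root om).

Definition chi w p : K := om ^+ pairing w p.

Lemma om_expD (x y : 'I_n.+1) : om ^+ (x + y)%R = om ^+ x * om ^+ y.
Proof. by rewrite /= (prim_expr_mod om_prim) exprD. Qed.

Lemma chiDr w p q : chi w (p + q)%MM = chi w p * chi w q.
Proof. by rewrite /chi pairingDr om_expD. Qed.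

Lemma chiDl v w p : chi (v + w) p = chi v p * chi w p.
Proof. by rewrite /chi pairingDl om_expD. Qed.

Lemma chi0r w : chi w 0%MM = 1.
Proof. by rewrite /chi pairing0r. Qed.

Lemma chi_eq1 w p : (chi w p == 1) = (pairing w p == 0).
Proof.
rewrite /chi -(expr0 om) (eq_prim_root_expr om_prim) mod0n modn_small //.
Qed.

Lemma chi_neq0 w p : chi w p != 0.
Proof.
apply: expf_neq0; apply: contra_eq_neq (prim_expr_order om_prim) => ->.
by rewrite expr0n /= eq_sym oner_eq0.
Qed.

Lemma chiMn w p k : chi w (p *+ k)%MM = chi w p ^+ k.
Proof. by elim: k => [|k IH]; rewrite ?chi0r // mulmS chiDr IH exprS. Qed.

(** The proof argument is an index by which the inference of the ring morphism
    structure finds that [om] is a root of unity. *)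
Definition torsion_act (_ : n.+1.-primitive_root om) w : mps e K -> mps e K :=
  rescale (chi w).
Local Notation act := (torsion_act om_prim).

Lemma act_is_zmod w : zmod_morphism (act w).
Proof. exact: rescale_is_zmod. Qed.

Lemma act_is_monoid w : monoid_morphism (act w).
Proof.
split; last by move=> a b; apply: rescaleM => p q; apply: chiDr.
apply/mpsP => p; rewrite -[LHS]/(chi w p * (1 : mps e K) p) mps1E.
by case: eqP => [->|_]; rewrite ?mulr0 // chi0r mulr1.
Qed.

HB.instance Definition _ w := GRing.isZmodMorphism.Build (mps e K) (mps e K)
  (torsion_act om_prim w) (act_is_zmod w).
HB.instance Definition _ w := GRing.isMonoidMorphism.Build (mps e K) (mps e K)
  (torsion_act om_prim w) (act_is_monoid w).

Lemma actE w a p : act w a p = chi w p * a p.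
Proof. by []. Qed.

Lemma actD v w a : act (v + w) a = act v (act w a).
Proof. by apply/mpsP => p; rewrite !actE chiDl mulrA. Qed.

Lemma act0 a : act 0 a = a.
Proof. by apply/mpsP => p; rewrite actE /chi pairing0l expr0 mul1r. Qed.

Lemma act_inj w : injective (act w).
Proof.
by move=> a b E; rewrite -(act0 a) -(act0 b) -(addNr w) !actD E.
Qed.

Lemma act_pow w a : act w (mps_pow n.+1 a) = mps_pow n.+1 a.
Proof.
apply/mpsP => p; rewrite actE.
have [-> |nz] := eqVneq (mps_pow n.+1 a p) 0; first by rewrite mulr0.
have [q ->] := mps_pow_supp nz.
have /eqP -> : chi w (q *+ n.+1)%MM == 1 by rewrite chi_eq1 pairing_mul.
by rewrite mul1r.
Qed.

Definition root_pow (a : mps e K) : mps e K := Mps (fun p => a (p *+ n.+1)%MM).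

(** An exponent fixed by the whole group is a multiple of [n.+1]. *)
Lemma act_invariant a : (forall w, act w a = a) -> mps_pow n.+1 (root_pow a) = a.
Proof.
move=> inv; apply/mpsP => p.
have [[q ->]|np] := pselect (exists q, p = (q *+ n.+1)%MM).
  by rewrite mps_powE.
transitivity (0 : K).
  by apply/eqP/negP => /negP nz; apply: np; apply: mps_pow_supp nz.
apply/esym/eqP/negP => /negP nz; apply: np; apply: pairing_all0 => w.
apply/eqP; rewrite -chi_eq1; apply/eqP; apply: (mulIf nz).
by rewrite mul1r -actE inv.
Qed.

Lemma act_lead w P p A :
  lead P p A -> lead (map_poly (act w) P) p (chi w p *: A).
Proof.
move=> lP i; rewrite coef_map coefZ; split=> [s sp|].
  by rewrite /= (lP i).1 ?mulr0.
by rewrite /= (lP i).2.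
Qed.

End TorsionGroup.

(** * Maximal minors and annihilators *)

Section Minors.
Context (e N : nat).
Implicit Types (A : 'M[int]_(e, N)).

Definition increasing (s : {ffun 'I_e -> 'I_N}) : bool :=
  [forall a : 'I_e, forall b : 'I_e, (a < b)%N ==> (s a < s b)%N].

Definition minors_gcd A : nat :=
  \big[gcdn/0%N]_(s : {ffun 'I_e -> 'I_N} | increasing s) `|\det (colsub s A)|%N.

(** Each column of [A *m B] is a combination of columns of [A], and the determinant
    is multilinear. *)
Lemma det_mulmx_expand (R : comNzRingType) (A : 'M[R]_(e, N)) (B : 'M[R]_(N, e)) :
  \det (A *m B)
  = \sum_(f : {ffun 'I_e -> 'I_N}) (\prod_j B (f j) j) * \det (colsub f A).
Proof.
rewrite -det_tr trmx_mul; set A' := A^T; set B' := B^T.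
transitivity (\sum_(f : {ffun 'I_e -> 'I_N}) \sum_(s : 'S_e)
    (-1) ^+ s * \prod_i (B' i (f i) * A' (f i) (s i))).
  rewrite exchange_big; apply: eq_bigr => /= s _; rewrite -big_distrr /=.
  congr (_ * _); rewrite -(bigA_distr_bigA (fun i j => B' i j * A' j (s i))) /=.
  by apply: eq_bigr => x _; rewrite mxE.
apply: eq_bigr => f _; rewrite -(det_tr (colsub f A)) big_distrr /=.
apply: eq_bigr => s _; rewrite mulrCA; congr (_ * _).
by rewrite big_split /=; congr (_ * _); apply: eq_bigr => i _; rewrite !mxE.
Qed.

(** A repeated column makes the minor vanish, and other choices of columns are
    permutations of increasing ones. *)
Lemma dvdn_minor (g : nat) A (f : {ffun 'I_e -> 'I_N}) :
    (forall s, increasing s -> (g%:Z %| \det (colsub s A))%Z) ->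
  (g%:Z %| \det (colsub f A))%Z.
Proof.
move=> gdvd; have [/injectiveP inj|] := boolP (injectiveb f); last first.
  case/injectivePn => i [j ij Eij].
  have -> : \det (colsub f A) = 0; last exact: dvdz0.
  rewrite -det_tr; apply: (determinant_alternate ij) => k.
  by rewrite !mxE Eij.
pose t := [tuple f i | i < e]; pose leqo : rel 'I_N := fun a b => (a <= b)%N.
have /tuple_permP[s sE] : perm_eq (sort leqo t) t by rewrite perm_sort.
pose g' : {ffun 'I_e -> 'I_N} := [ffun i => f (s i)].
have g'E : codom g' = sort leqo t.
  rewrite sE codomE; apply: eq_map => i; rewrite ffunE tnth_mktuple //.
have dE : \det (colsub g' A) = (-1) ^+ s * \det (colsub f A).
  have -> : colsub g' A = col_perm s (colsub f A).
    by apply/matrixP => i j; rewrite !mxE ffunE.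
  by rewrite col_permE det_mulmx det_perm mulrC odd_permV.
have /gdvd : increasing g'.
  have srt : sorted leqo (codom g').
    by rewrite g'E; apply: sort_sorted => a b /=; apply: leq_total.
  apply/'forall_forallP => a b; apply/implyP => ab.
  rewrite ltn_neqAle; apply/andP; split.
    apply: contraTneq ab => /val_inj; rewrite !ffunE => /inj /perm_inj ->.
    by rewrite ltnn.
  have tr : transitive leqo by move=> x y z /=; apply: leq_trans.
  have sz : size (codom g') = e by rewrite size_codom card_ord.
  have := sorted_ltn_nth tr (g' a) srt (nat_of_ord a) (nat_of_ord b).
  rewrite !inE sz !ltn_ord => /(_ isT isT ab).
  have nthE (i : 'I_e) : nth (g' a) (codom g') i = g' i.
    rewrite codomE (nth_map a); last by rewrite size_enum_ord.
    by rewrite nth_ord_enum.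
  by rewrite !nthE.
by rewrite dE dvdzE abszMsign -dvdzE.
Qed.

Lemma minors_gcd_dvd A s : increasing s ->
  ((minors_gcd A)%:Z %| \det (colsub s A))%Z.
Proof. by move=> inc; rewrite dvdzE /=; apply: biggcdn_inf inc _. Qed.

(** The gcd of the minors depends only on the lattice spanned by the columns: it
    divides the determinant of any [e] vectors of the lattice. *)
Lemma minors_gcd_dvd_mul A (B : 'M_(N, e)) :
  ((minors_gcd A)%:Z %| \det (A *m B))%Z.
Proof.
rewrite det_mulmx_expand; apply: rpred_sum => f _.
by apply: dvdz_mull; apply: dvdn_minor => s; apply: minors_gcd_dvd.
Qed.

End Minors.

Section Duality.
Context (e n : nat).
Implicit Types (w : torsion e n).

Definition mact (k l : nat) (w : torsion k n) (A : 'M[int]_(k, l)) : torsion l n :=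
  [ffun j => \sum_i w i *~ A i j].

Lemma mactM k l r (w : torsion k n) (A : 'M_(k, l)) (B : 'M_(l, r)) :
  mact w (A *m B) = mact (mact w A) B.
Proof.
apply/ffunP => j; rewrite !ffunE.
transitivity (\sum_i \sum_x w i *~ (A i x * B x j)).
  apply: eq_bigr => i _; rewrite mxE.
  exact: (big_morph _ (mulrzDr (w i)) (mulr0z (w i))).
rewrite exchange_big; apply: eq_bigr => x _; rewrite ffunE /=.
rewrite (big_morph (fun v : 'I_n.+1 => v *~ B x j)
  (mulrzDl (B x j)) (mul0rz _ (B x j))).
by apply: eq_bigr => i _; rewrite mulrzA.
Qed.

Lemma mact1 k (w : torsion k n) : mact w 1%:M = w.
Proof.
apply/ffunP => j; rewrite ffunE (bigD1 j) //= mxE eqxx mulr1z big1 ?addr0 //.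
by move=> i /negPf ij; rewrite mxE ij mulr0z.
Qed.

Lemma mact0 k l (A : 'M_(k, l)) : mact (0 : torsion k n) A = 0.
Proof. by apply/ffunP => j; rewrite !ffunE big1 // => i _; rewrite ffunE mul0rz. Qed.

Lemma ord_mulrz_eq0 (x : 'I_n.+1) (z : int) :
  (x *~ z == 0) = (n.+1 %| x * `|z|)%N.
Proof.
case: z => k; first exact: ord_mulrn_eq0.
by rewrite NegzE mulrNz oppr_eq0 ord_mulrn_eq0 abszN.
Qed.

Lemma card_ord_torsion d : (d %| n.+1)%N ->
  #|[pred x : 'I_n.+1 | (n.+1 %| x * d)%N]| = d.
Proof.
case/dvdnP => c nE.
have [c0 d0] : (0 < c)%N /\ (0 < d)%N.
  by apply/andP; rewrite -muln_gt0 -nE.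
have lt (y : 'I_d) : (c * y < n.+1)%N by rewrite nE ltn_pmul2l.
pose F (y : 'I_d) : 'I_n.+1 := Ordinal (lt y).
have injF : injective F.
  move=> y z /(congr1 val)/eqP /=; rewrite eqn_pmul2l // => /eqP.
  exact: val_inj.
rewrite -[RHS]card_ord -(card_image injF); apply: eq_card => x.
rewrite inE; apply/idP/imageP => [|[y _ ->]]; last first.
  by rewrite /= nE mulnAC dvdn_mulr.
have -> : (n.+1 %| x * d)%N = (c %| x)%N by rewrite -(dvdn_pmul2r (d := c) (m := x) d0) -nE.
case/dvdnP => y xE.
have ltyd : (y < d)%N.
  by rewrite -(ltn_pmul2r c0) -xE [(d * c)%N]mulnC -nE.
by exists (Ordinal ltyd) => //; apply: val_inj; rewrite /= mulnC.
Qed.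

Context (N : nat) (A : 'M[int]_(e, N)) (X : 'M[int]_(N, e)).
Hypotheses (eN : (e <= N)%N) (AX : A *m X = n.+1%:Z%:M).

(** The elementary divisors divide [n.+1], since the columns of [A] span a lattice
    that contains the multiples of [n.+1]. *)
Lemma smith_diag : exists (L : 'M[int]_e) (R : 'M[int]_N) (d : 'I_e -> int),
  [/\ L \in unitmx, R \in unitmx, forall i, (d i %| n.+1%:Z)%Z &
      A = L *m (\matrix_(i, j) (d i *+ (i == j :> nat))) *m R].
Proof.
have [L uL [R uR [d _ AE]]] := int_Smith_normal_form A.
exists L, R, (fun i : 'I_e => d`_i); split=> // i.
pose D : 'M[int]_(e, N) := \matrix_(i, j) (d`_i *+ (i == j :> nat)).
have E : D *m (R *m X *m L) = n.+1%:Z%:M.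
  have : invmx L *m (A *m X) *m L = n.+1%:Z%:M.
    by rewrite AX scalar_mxC -mulmxA mulVmx // mulmx1.
  by rewrite AE -!mulmxA (mulmxA (invmx L) L) mulVmx // mul1mx.
have : (n.+1%:Z%:M : 'M[int]_e) i i = n.+1%:Z by rewrite mxE eqxx mulr1n.
rewrite -E mxE => <-; apply: rpred_sum => j _; rewrite mxE.
by case: eqP => _; rewrite ?mulr1n ?dvdz_mulr // mulr0n mul0r dvdz0.
Qed.

Lemma mact_diag (v : torsion e n) (d : 'I_e -> int) :
  (mact v (\matrix_(i < e, j < N) (d i *+ (i == j :> nat))) == 0)
  = [forall i, v i *~ d i == 0].
Proof.
apply/eqP/forallP => [/ffunP H i|H].
  have := H (widen_ord eN i); rewrite !ffunE (bigD1 i) //= mxE eqxx mulr1n.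
  rewrite big1 ?addr0 => [->//|k ki].
  by rewrite mxE /= (inj_eq val_inj) (negPf ki) mulr0z.
apply/ffunP => j; rewrite !ffunE big1 // => i _; rewrite mxE.
by case: eqP => _; rewrite ?mulr0z // mulr1n; apply/eqP.
Qed.

Definition annihilator : {set torsion e n} := [set w | mact w A == 0].

(** The Smith form [A = L D R] turns both sides into the product of the
    elementary divisors, all of which divide [n.+1]. *)
Lemma card_annihilator : #|annihilator| = minors_gcd A.
Proof.
have [L [R [d [uL uR dn AE]]]] := smith_diag.
set D := (\matrix_(_, _) _) in AE.
have annE w : (w \in annihilator) = [forall i, mact w L i *~ d i == 0].
  rewrite inE -mact_diag -/D AE !mactM; apply/eqP/eqP => [H|->]; last exact: mact0.
  by rewrite -[LHS]mact1 -(mulmxV uR) mactM H mact0.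
transitivity (\prod_i `|d i|)%N.
  pose F (i : 'I_e) := [pred x : 'I_n.+1 | (n.+1 %| x * `|d i|)%N].
  transitivity #|family F|; last first.
    rewrite card_family foldrE big_map big_enum /=; apply: eq_bigr => i _.
    by apply: card_ord_torsion; have := dn i; rewrite dvdzE.
  have injL : injective (fun w : torsion e n => mact w L).
    move=> v w E; rewrite -(mact1 v) -(mact1 w) -(mulmxV uL) !mactM.
    by congr mact.
  rewrite -(card_imset _ injL); apply: eq_card => v; apply/imsetP/familyP.
    case=> w; rewrite annE => /forallP H -> i; rewrite inE.
    by rewrite -ord_mulrz_eq0.
  move=> H; exists (mact v (invmx L)); last by rewrite -mactM mulVmx // mact1.
  rewrite annE -mactM mulVmx // mact1; apply/forallP => i.
  by rewrite ord_mulrz_eq0; have := H i; rewrite inE.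
pose E : 'M[int]_(e, N) := \matrix_(i, j) (i == j :> nat)%:R.
have DE : D = diag_mx (\row_i d i) *m E.
  apply/matrixP => i j; rewrite mul_diag_mx !mxE.
  by case: eqP; rewrite ?mulr1 ?mulr0.
have EEt : E *m E^T = 1%:M.
  apply/matrixP => i j; rewrite !mxE (bigD1 (widen_ord eN i)) //= !mxE eqxx mul1r.
  rewrite big1 ?addr0 => [|k ki]; first by rewrite eq_sym.
  rewrite mxE; case: eqP => [ik|]; last by rewrite mul0r.
  by case/eqP: ki; apply: val_inj.
have detD : \det (diag_mx (\row_i d i)) = \prod_i d i.
  by rewrite det_diag; apply: eq_bigr => i _; rewrite mxE.
have absL : `|\det L|%N = 1%N by move: uL; rewrite unitmxE qualifE => /orP[] /eqP ->.
have prodE : absz (\prod_i d i) = (\prod_i `|d i|)%N.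
  exact: (big_morph absz abszM).
apply/eqP; rewrite eqn_dvd; apply/andP; split.
  rewrite -prodE; apply/dvdn_biggcdP => s _.
  have -> : colsub s A = L *m diag_mx (\row_i d i) *m (E *m colsub s R).
    rewrite AE DE -!mulmxA; apply/matrixP => i j.
    by rewrite [LHS]mxE !mulmxA; rewrite [LHS]mxE [RHS]mxE; apply: eq_bigr => k _; rewrite [colsub _ _ _ _]mxE.
  by rewrite !det_mulmx detD !abszM absL mul1n dvdn_mulr.
have := minors_gcd_dvd_mul A (invmx R *m E^T).
have -> : A *m (invmx R *m E^T) = L *m diag_mx (\row_i d i).
  rewrite AE DE -!mulmxA (mulmxA R) mulmxV // mul1mx EEt mulmx1 //.
by rewrite det_mulmx detD dvdzE abszM absL mul1n prodE.
Qed.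

(** If, in the basis given by the Smith form, the [i]-th coordinate of [p] is not
    divisible by the elementary divisor [d i], then the element with the only
    coordinate [n.+1 / d i], at [i], kills the lattice but not [p]. *)
Lemma annihilator_separates (p : 'cV[int]_e) :
  (forall Y : 'cV_N, p <> A *m Y) ->
  exists2 w, w \in annihilator & mact w p != 0.
Proof.
move=> notin; have [L [R [d [uL uR dn AE]]]] := smith_diag.
set D := (\matrix_(_, _) _) in AE.
pose q := invmx L *m p.
have [i ndvd] : exists i, ~~ (d i %| q i ord0)%Z.
  apply/existsP; rewrite -negb_forall; apply/negP => /forallP dvd.
  pose Y : 'cV[int]_N := \col_j (if insub (val j) is Some i then
                                 (q i ord0 %/ d i)%Z else 0).
  apply: (notin (invmx R *m Y)).
  rewrite AE -!mulmxA (mulmxA R) mulmxV // mul1mx.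
  suff -> : D *m Y = q by rewrite mulmxA mulmxV // mul1mx.
  apply/matrixP => i j; rewrite ord1 mxE (bigD1 (widen_ord eN i)) //= [D _ _]mxE [Y _ _]mxE eqxx.
  rewrite mulr1n /= (valK i) mulrC divzK // big1 ?addr0 // => k ki.
  rewrite mxE; case: eqP => [ik|]; last by rewrite mulr0n mul0r.
  by case/eqP: ki; apply: val_inj.
have := dn i; rewrite dvdzE /= => /dvdnP[c nE].
have [c0 d0] : (0 < c)%N /\ (0 < `|d i|)%N.
  by apply/andP; rewrite -muln_gt0 -nE.
pose v : torsion e n := [ffun k => if k == i then inord 1 *+ c else 0].
have nc z : (inord 1 *+ c *~ z == 0 :> 'I_n.+1) = (n.+1 %| c * `|z|)%N.
  rewrite ord_mulrz_eq0 ord_mulrn_val.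
  (* for [n = 0] the group is trivial and both sides hold *)
  case: (n) => [|k]; first by rewrite !dvd1n.
  by rewrite inordK // mul1n /dvdn modnMml.
exists (mact v (invmx L)).
  rewrite inE AE -!mactM !mulmxA mulVmx // mul1mx mactM.
  suff /eqP -> : mact v D == 0 by rewrite mact0.
  rewrite mact_diag; apply/forallP => k; rewrite ffunE.
  case: (k =P i) => [->|_]; last by rewrite mul0rz.
  by rewrite nc -nE.
rewrite -mactM -/q; apply: contra ndvd => /eqP/ffunP/(_ 0).
rewrite !ffunE (bigD1 i) //= ffunE eqxx big1 ?addr0 => [/eqP|k ki].
  by rewrite nc nE dvdn_pmul2l // dvdzE.
by rewrite ffunE (negPf ki) mul0rz.
Qed.

End Duality.

(** * Duality between lattices and torsion groups *)

Section LatticeDuality.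
Context (e n h : nat) (m : 'I_h -> 'X_{1..e}).

Definition annih (P : pred 'I_h) : {set torsion e n} :=
  [set w | [forall j, P j ==> (pairing w (m j) == 0)]].

Lemma annihP (P : pred 'I_h) w :
  reflect (forall j, P j -> pairing w (m j) = 0) (w \in annih P).
Proof.
rewrite inE; apply: (iffP forallP) => H j; last by apply/implyP => /H ->.
by move=> Pj; apply/eqP; move/implyP: (H j); apply.
Qed.

Lemma char_mx_full (i : 'I_h.+1) :
  char_mx n.+1 m i *m col_mx 1%:M 0 = n.+1%:Z%:M.
Proof. by rewrite /char_mx mul_row_col mulmx1 mulmx0 addr0. Qed.

Lemma annihilator_char_mx (i : 'I_h.+1) :
  annihilator n (char_mx n.+1 m i) = annih [pred j : 'I_h | j < i]%N.
Proof.
apply/setP => w; rewrite [LHS]inE; apply/eqP/annihP => [/ffunP H j ji|H].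
  have := H (rshift e (Ordinal ji)); rewrite !ffunE => <-.
  apply: eq_bigr => l _; rewrite /char_mx row_mxEr mxE.
  by congr (_ *~ Posz (m _ _)); apply: val_inj.
apply/ffunP => c; rewrite !ffunE /char_mx; case: (split_ordP c) => [l ->|j ->].
  rewrite (bigD1 l) //= row_mxEl mxE eqxx mulr1n big1 => [|k /negPf kl].
    by rewrite addr0; apply/eqP; rewrite ord_mulrz_eq0 dvdn_mull.
  by rewrite row_mxEl mxE kl mulr0n mulr0z.
rewrite -[RHS](H (widen_ord (leq_ord i) j)) /=; last exact: ltn_ord.
by apply: eq_bigr => l _; rewrite row_mxEr mxE.
Qed.

Lemma char_gcd_card (i : 'I_h.+1) :
  char_gcd n.+1 m i = #|annih [pred j : 'I_h | j < i]%N|.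
Proof.
rewrite -annihilator_char_mx (card_annihilator (leq_addr i e) (char_mx_full i)).
by [].
Qed.

Lemma in_lattice_annih P p w :
  in_lattice n.+1 m P p -> w \in annih P -> pairing w p = 0.
Proof.
move=> [a [z E]] /annihP H.
transitivity (\sum_l (w l *~ (n.+1%:Z * a l) + \sum_(j | P j) w l *~ (z j * (m j l)%:Z))).
  apply: eq_bigr => l _; rewrite -[LHS]/(w l *~ (p l)%:Z) E mulrzDr; congr (_ + _).
  exact: (big_morph _ (mulrzDr (w l)) (mulr0z (w l))).
rewrite big_split /= big1 ?add0r => [|l _]; last first.
  by apply/eqP; rewrite ord_mulrz_eq0 abszM mulnCA dvdn_mulr.
rewrite exchange_big big1 //= => j Pj.
transitivity (pairing w (m j) *~ z j); last by rewrite H // mul0rz.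
rewrite /pairing (big_morph (fun v : 'I_n.+1 => v *~ z j)
  (mulrzDl (z j)) (mul0rz _ (z j))).
by apply: eq_bigr => l _; rewrite mulrC mulrzA.
Qed.

Lemma not_in_lattice_annih (i : 'I_h.+1) p :
  ~ in_lattice n.+1 m [pred j : 'I_h | j < i]%N p ->
  exists2 w, w \in annih [pred j : 'I_h | j < i]%N & pairing w p != 0.
Proof.
move=> notin.
have [Y E|w] := annihilator_separates (leq_addr i e) (char_mx_full i)
  (p := \col_l (p l)%:Z).
  apply: notin; exists (fun l => Y (lshift i l) 0).
  exists (fun j => oapp (fun j' : 'I_i => Y (rshift e j') 0) 0 (insub (val j))) => l.
  have /matrixP/(_ l 0) := E; rewrite !mxE => ->.
  rewrite big_split_ord /=; congr (_ + _).
    rewrite (bigD1 l) //= /char_mx row_mxEl mxE eqxx mulr1n big1 ?addr0 // => k kl.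
    by rewrite row_mxEl mxE eq_sym (negPf kl) mulr0n mul0r.
  rewrite (big_ord_narrow (leq_ord i)); apply: eq_bigr => j _.
  by rewrite /char_mx row_mxEr mxE /= (valK j) /= mulrC.
rewrite annihilator_char_mx => aw nz; exists w => //.
apply: contra nz => /eqP z; apply/eqP/ffunP => j; rewrite !ffunE -[RHS]z.
by apply: eq_bigr => l _; rewrite mxE.
Qed.

End LatticeDuality.

(** * Divisors of monomials and the discriminant *)

Section MonomialDivisors.
Context (e : nat) (K : idomainType).
Implicit Types (a b : mps e K).

(** The series obtained by setting the variable [t_l] to 0 *)
Definition erase (l : 'I_e) a : mps e K :=
  Mps (fun p => if p l == 0%N then a p else 0).

(** Setting [t_l] to [0] is a morphism to a domain, so its kernel is prime. *)
Lemma eraseM l a b : erase l (a * b) = erase l a * erase l b.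
Proof.
apply/mpsP => p; rewrite [RHS]mpsME.
transitivity (if p l == 0%N then (a * b) p else 0) => //.
case: eqP => [p0|/eqP pl]; last first.
  rewrite big1 // => i ip /=; case: eqP => [i0|]; last by rewrite mul0r.
  by rewrite mnmBE i0 subn0 (negPf pl) mulr0.
rewrite mpsME; apply: eq_bigr => i /mnm_lepP/(_ l); rewrite p0 leqn0 => /eqP i0.
by rewrite /= i0 mnmBE p0 eqxx.
Qed.

Lemma erase_eq0 l a : erase l a = 0 -> exists c, a = mpsX K U_(l)%MM * c.
Proof.
move=> /mpsP E; eexists; apply: mpsX_divides => p ap; rewrite lep1mP.
by apply: contra ap => pl; have /= := E p; rewrite pl => ->.
Qed.

(** The variables are prime elements, so a divisor of a monomial is a monomial
    times a unit. *)
Lemma monomial_divisor N a b : a * b = mpsX K N ->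
  exists2 mu, a mu != 0 & forall p, a p != 0 -> (mu <= p)%MM.
Proof.
have [d] := ubnP (mdeg N); elim: d N a b => // d IH N a b; rewrite ltnS => dN ab.
have [N0|] := eqVneq N 0%MM.
  exists 0%MM; last by move=> p _; apply/mnm_lepP => i; rewrite mnmE.
  have := (mpsP _ _).2 ab 0%MM.
  rewrite mpsME big_mkcond (bigD1_seq 0%MM) ?below_uniq ?mem_below //= big1.
    rewrite addr0 N0 eqxx /= lepm_refl => E.
    by apply: contra_eq_neq E => ->; rewrite mul0r eq_sym oner_eq0.
  move=> i /negPf i0; case: ifP => // /mnm_lepP H.
  by case/eqP: i0; apply/mnmP => j; apply/eqP; have := H j; rewrite !mnmE leqn0.
rewrite -mdeg_eq0 mdegE sum_nat_eq0 negb_forall => /existsP[l /= Nl].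
have lN : (U_(l) <= N)%MM by rewrite lep1mP.
pose N' := (N - U_(l))%MM.
have NE : N = (U_(l) + N')%MM by rewrite addmC submK.
have dN' : (mdeg N' < d)%N.
  by apply: leq_trans dN; rewrite [in X in (_ < X)%N]NE mdegD mdeg1.
have X0 : mpsX K (U_(l) : 'X_{1..e})%MM != 0 by apply: mpsX_neq0.
have /eqP : erase l a * erase l b = 0.
  rewrite -eraseM ab; apply/mpsP => p /=; case: eqP => // pl.
  by case: eqP => // pN; rewrite -pN pl eqxx in Nl.
rewrite mulf_eq0 => /orP[]/eqP/erase_eq0[c cE].
  have [|mu cmu muc] := IH N' c b dN'.
    by apply: (mulfI X0); rewrite mulrA -cE ab {1}NE mpsXD.
  have aE p : a p = if (U_(l) <= p)%MM then c (p - U_(l))%MM else 0.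
    by rewrite cE mpsX_mulE.
  exists (mu + U_(l))%MM; first by rewrite aE lem_addl addmK.
  move=> p; rewrite aE; case: ifP => [lp /muc le|]; last by rewrite eqxx.
  apply/mnm_lepP => i; rewrite mnmDE -(submK lp) mnmDE leq_add2r.
  exact: (mnm_lepP le).
apply: (IH N' a c dN').
by apply: (mulfI X0); rewrite mulrCA -cE ab {1}NE mpsXD.
Qed.

End MonomialDivisors.

Section Discriminant.
Context (e n : nat) (K : idomainType).
Hypothesis charK : [pchar K] =i pred0.
Local Notation R := (mps e K).

Lemma mps_natE k p : (k%:R : R) p = if p == 0%MM then k%:R else 0.
Proof. by rewrite -cmps_nat. Qed.

Lemma mps_nat_neq0 k : (0 < k)%N -> k%:R != 0 :> R.
Proof.
move=> k0; apply/eqP => /mpsP/(_ 0%MM); rewrite mps_natE eqxx => /eqP.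
by rewrite (pcharf0P K).1 // eqn0Ngt k0.
Qed.

Lemma two_roots_factor (S : idomainType) (P : {poly S}) (a b : S) :
  P.[a] = 0 -> P.[b] = 0 -> a != b -> exists c, P^`().[a] = (a - b) * c.
Proof.
move=> /rootP/factor_theorem[Q PE] + ab; rewrite PE hornerM hornerXsubC => /eqP.
rewrite mulf_eq0 subr_eq0 [b == a]eq_sym (negPf ab) orbF => /eqP/rootP/factor_theorem[T ->].
exists T.[a]; rewrite !derivM !derivXsubC.
by rewrite !(hornerE, hornerM, hornerXsubC) subrr !(mulr0, add0r, mulr1) mulrC.
Qed.

(** The difference of two roots divides the discriminant. *)
Lemma root_diff_dvd_discr (f : {poly R}) (a b : R) :
    f \is monic -> a != b ->
    (map_poly (mps_pow n.+1) f).[a] = 0 -> (map_poly (mps_pow n.+1) f).[b] = 0 ->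
  exists c, mps_pow n.+1 (discr f) = (a - b) * c.
Proof.
move=> fm ab fa fb.
pose phi : {rmorphism R -> R} := @mps_pow e K n.+1.
have sz : (2 < size f)%N.
  have sf : size (map_poly phi f) = size f.
    by rewrite size_map_poly_id0 // (monicP fm) rmorph1 oner_eq0.
  rewrite -sf; apply: (@max_poly_roots _ (map_poly phi f) [:: a; b]) => /=.
  - by rewrite -size_poly_gt0 sf size_poly_gt0 monic_neq0.
  - by rewrite /root fa fb eqxx.
  - by rewrite inE ab.
have sz' : (1 < size f^`())%N.
  rewrite ltnNge; apply/negP => le.
  have : f^`()`_(size f).-2 = 0.
    by rewrite nth_default // (leq_trans le) // -subn2 ltn_subRL.
  rewrite coef_deriv -[(size f).-2.+1]/((size f).-2.+1).
  have -> : (size f).-2.+1 = (size f).-1 by case: (size f) sz => [|[]].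
  have := monicP fm; rewrite lead_coefE => -> /eqP.
  by rewrite (negPf (mps_nat_neq0 _)) //; case: (size f) sz => [|[]].
have [[u v] _ /= E] := resultant_in_ideal (ltnW sz) sz'.
have [c cE] := two_roots_factor fa fb ab.
have : phi (resultant f f^`()) = (map_poly phi v).[a] * ((a - b) * c).
  have := congr1 (fun q => (map_poly phi q).[a]) E.
  rewrite map_polyC hornerC rmorphD !rmorphM hornerD !hornerM /= fa mulr0 add0r.
  by rewrite -deriv_map cE.
rewrite /discr rmorphM => -> .
exists (phi ((-1) ^+ 'C((size f).-1, 2)) * ((map_poly phi v).[a] * c)).
by rewrite [RHS]mulrCA; congr (_ * _); rewrite [RHS]mulrCA.
Qed.

Lemma quasi_ordinary_root_diff (f : {poly R}) (a b : R) :
    f \is monic -> quasi_ordinary f -> a != b ->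
    (map_poly (mps_pow n.+1) f).[a] = 0 -> (map_poly (mps_pow n.+1) f).[b] = 0 ->
  exists2 mu, (a - b) mu != 0 & forall p, (a - b) p != 0 -> (mu <= p)%MM.
Proof.
move=> fm [N [u [uu dE]]] ab fa fb.
have [c cE] := root_diff_dvd_discr fm ab fa fb.
apply: (@monomial_divisor _ _ (N *+ n.+1)%MM (a - b) (c * mps_pow n.+1 u^-1)).
rewrite mulrA -cE dE -rmorphM -mulrA divrr // mulr1; exact: mps_powX.
Qed.

End Discriminant.

(** * Division by monic polynomials *)

Section MonicDivision.
Context (S : idomainType).
Implicit Types (P g q r : {poly S}).

Lemma monic_division P g : g \is monic ->
  exists q r, [/\ P = q * g + r, (size r < size g)%N &
    q != 0 -> size P = (size q + (size g).-1)%N].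
Proof.
move=> gm; exists (Pdiv.Ring.rdivp P g), (Pdiv.Ring.rmodp P g).
have PE := Pdiv.RingMonic.rdivp_eq gm P.
have lt : (size (Pdiv.Ring.rmodp P g) < size g)%N.
  by rewrite Pdiv.Ring.ltn_rmodp monic_neq0.
split=> // q0; set q := Pdiv.Ring.rdivp P g in PE q0 *.
have sqg : size (q * g) = (size q + (size g).-1)%N.
  by rewrite size_Mmonic // -!subn1 addnBA // size_poly_gt0 monic_neq0.
rewrite {1}PE size_polyDl sqg //; apply: leq_trans lt _.
by rewrite {1}(polySpred (monic_neq0 gm)) -add1n leq_add2r size_poly_gt0.
Qed.

Lemma size_monic_exp g N i : g \is monic -> size g = N.+1 ->
  size (g ^+ i) = (N * i).+1.
Proof.
move=> gm sg; have g0 : g ^+ i != 0 by rewrite monic_neq0 ?monic_exp.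
by rewrite (polySpred g0) size_exp sg.
Qed.

Lemma monic_expansion g N E P : g \is monic -> size g = N.+1 ->
    (size P <= N * E)%N ->
  exists b : nat -> {poly S}, (forall i, size (b i) <= N)%N /\
    P = \sum_(i < E) b i * g ^+ i.
Proof.
move=> gm sg; elim: E P => [|E IH] P le.
  exists (fun=> 0); split=> [i|]; first by rewrite size_poly0.
  by apply/eqP; rewrite big_ord0 -size_poly_leq0 (leq_trans le) // muln0.
have [q [r [PE lt sP]]] := monic_division P gm.
have [|b [bN qE]] := IH q.
  have [->|q0] := eqVneq q 0; first by rewrite size_poly0.
  by move: le; rewrite sP // sg mulnS addnC leq_add2l.
exists (fun i => if i is j.+1 then b j else r); split=> [[|i]|].
- by rewrite -ltnS -sg.
- exact: bN.
rewrite big_ord_recl expr0 mulr1 addrC PE; congr (_ + _).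
rewrite qE mulr_suml; apply: eq_bigr => i _.
by rewrite -mulrA -exprSr.
Qed.

(** One Tschirnhausen step: adding [q / d] to [g] cancels the term [q g^(d-1)] of
    [f - g^d]; the remaining binomial terms have smaller degree. *)
Lemma tschirnhausen_size (f g q r : {poly S}) (N d : nat) (c : S) :
    g \is monic -> size g = N.+1 -> (0 < d)%N -> c * d%:R = 1 ->
    f - g ^+ d = q * g ^+ d.-1 + r -> q != 0 -> (size q <= N)%N ->
    (size r <= N * d.-1)%N ->
  (size (f - (g + c *: q) ^+ d)%R < size q + N * d.-1)%N.
Proof.
move=> gm sg d0 cd fE q0 qN rN.
have q1 : (0 < size q)%N by rewrite size_poly_gt0.
pose T := \sum_(i < d.-1) (g ^+ (d.-1 - i.+1) * (c *: q) ^+ i.+2) *+ 'C(d, i.+2).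
have -> : f - (g + c *: q) ^+ d = r - T.
  rewrite exprDn; case: d d0 cd fE rN @T => // d' _ cd fE rN T.
  rewrite big_ord_recl big_ord_recl /= subn0 expr0 mulr1 bin0 mulr1n.
  rewrite /bump /= -[(1 + 0)%N]/1%N subSS subn0 expr1 bin1.
  have -> : (g ^+ d' * (c *: q)) *+ d'.+1 = q * g ^+ d'.
    by rewrite -scalerAr -scaler_nat scalerA [_ * c]mulrC cd scale1r mulrC.
  rewrite opprD addrA fE /= opprD addrA [q * _ + r]addrC addrK.
  by congr (_ - _).
apply: (leq_ltn_trans (size_polyD _ _)); rewrite gtn_max size_polyN.
rewrite (leq_ltn_trans rN) /=; last by rewrite -[X in (X < _)%N]add0n ltn_add2r.
apply: (leq_ltn_trans (size_sum _ _ _)).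
have B0 : (0 < size q + N * d.-1)%N by rewrite addn_gt0 q1.
rewrite -(prednK B0) ltnS; apply/bigmax_leqP => i _; rewrite -ltnS prednK //.
rewrite -mulr_natr -[_%:R]/('C(d, i.+2)%:R) -polyC_natr mulrC mul_polyC.
apply: (leq_ltn_trans (size_scale_leq _ _)).
apply: (leq_ltn_trans (size_polyMleq _ _)).
rewrite (size_monic_exp _ gm sg) addSn /=.
have le : (size ((c *: q) ^+ i.+2) <= ((size q).-1 * i.+2).+1)%N.
  apply: (leq_trans (size_poly_exp_leq _ _)).
  rewrite ltnS leq_mul2r; apply/orP; right.
  by rewrite -!subn1 leq_sub2r // size_scale_leq.
apply: (@leq_ltn_trans (N * (d.-1 - i.+1) + ((size q).-1 * i.+2).+1)).
  by rewrite leq_add2l.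
have id := ltn_ord i.
have sq : ((size q).-1 * i.+2 < (size q).-1 + N * i.+1)%N.
  rewrite mulnSr addnC ltn_add2l ltn_mul2r /=.
  by rewrite -subn1 ltn_subLR ?add1n ?ltnS.
have -> : (N * d.-1 = N * (d.-1 - i.+1) + N * i.+1)%N.
  by rewrite -mulnDr subnK.
rewrite addnCA ltn_add2l -[X in (_ < X + _)%N](prednK q1) addSn ltnS.
exact: sq.
Qed.

(** The cofactor of [g1 - g2] in [g1 ^+ d - g2 ^+ d] is a sum of [d] monic
    polynomials of the same degree, so it keeps this degree. This gives the
    uniqueness of approximate roots. *)
Lemma size_exp_diff (g1 g2 : {poly S}) (N d : nat) :
    g1 \is monic -> g2 \is monic -> size g1 = N.+1 -> size g2 = N.+1 ->
    d%:R != 0 :> S -> g1 != g2 ->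
  (N * d.-1 < size (g1 ^+ d - g2 ^+ d)%R)%N.
Proof.
move=> m1 m2 s1 s2 d0 ne; rewrite subrXX; set T := \sum_(_ < _) _.
have dd : (0 < d)%N by case: (d) d0 => //; rewrite eqxx.
have TN : T`_(N * d.-1) != 0.
  rewrite coef_sum (eq_bigr (fun=> 1)) => [|i _].
    by rewrite sumr_const card_ord.
  have id : (i <= d.-1)%N by rewrite -ltnS prednK.
  have mi : g1 ^+ (d.-1 - i) * g2 ^+ i \is monic by rewrite monicMl monic_exp.
  have si : size (g1 ^+ (d.-1 - i) * g2 ^+ i) = (N * d.-1).+1.
    rewrite size_Mmonic ?monic_neq0 ?monic_exp //.
    rewrite (size_monic_exp _ m1 s1) (size_monic_exp _ m2 s2) addnS /=.
    by rewrite addSn -mulnDr subnK.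
  by have := monicP mi; rewrite lead_coefE si.
have sT : (N * d.-1 < size T)%N.
  by rewrite ltnNge; apply: contra TN => /(nth_default 0) ->.
have T0 : T != 0 by rewrite -size_poly_gt0 (leq_trans _ sT).
rewrite size_mul ?subr_eq0 //; apply: leq_trans sT _.
by rewrite (polySpred (_ : g1 - g2 != 0)) ?subr_eq0 // addSn /= leq_addl.
Qed.

End MonicDivision.

(** * Conjugates of the root *)

Lemma prod_XsubC_factor (S : idomainType) (P : {poly S}) (rs : seq S) :
  uniq rs -> all (root P) rs ->
  exists Q, P = Q * \prod_(a <- rs) ('X - a%:P).
Proof.
elim: rs P => [|a rs IH] P /=; first by exists P; rewrite big_nil mulr1.
case/andP=> ars Urs /andP[/factor_theorem[Q ->] rts].
have [|T ->] := IH Q Urs; last first.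
  by exists T; rewrite big_cons -mulrA; congr (_ * _); apply: mulrC.
apply/allP => b brs; have := allP rts b brs.
rewrite rootM root_XsubC => /orP[//|/eqP ba].
by rewrite -ba brs in ars.
Qed.

Section Conjugates.
Context (e n h : nat) (K : fieldType).
Hypothesis charK : [pchar K] =i pred0.
Context (om : K) (om_prim : n.+1.-primitive_root om).
Local Notation R := (mps e K).
Local Notation act := (torsion_act om_prim).
Local Notation chi := (chi om).
Local Notation pow := (@mps_pow e K n.+1).
Context (f : {poly R}) (y : R) (m : 'I_h -> 'X_{1..e}).
Hypotheses (f_monic : f \is monic) (f_deg : size f = n.+2).
Hypotheses (f_irr : irreducible_elt f) (f_qo : quasi_ordinary f).
Hypothesis y_root : (map_poly pow f).[y] = 0.
Hypothesis m_char : char_exponents n.+1 m y.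
Implicit Types (w v : torsion e n) (p q : 'X_{1..e}) (k j : nat).

(** The characteristic exponents as a sequence indexed by the natural numbers, with
    value [0] from [h] on. *)
Definition mexp k : 'X_{1..e} := oapp m 0%MM (insub k).

Lemma mexpE (i : 'I_h) : mexp i = m i.
Proof. by rewrite /mexp valK. Qed.

Lemma mexp_supp k : (k < h)%N -> y (mexp k) != 0.
Proof. by move=> kh; rewrite (mexpE (Ordinal kh)); case: m_char. Qed.

Lemma mexp_lt j k : (j < k)%N -> (k < h)%N -> (mexp j < mexp k)%MM.
Proof.
move=> jk kh; rewrite (mexpE (Ordinal kh)) (mexpE (Ordinal (ltn_trans jk kh))).
by case: m_char => _ H _ _; apply: H.
Qed.

Lemma mexp_le j k : (j <= k)%N -> (k < h)%N -> (mexp j <= mexp k)%MM.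
Proof.
rewrite leq_eqVlt => /orP[/eqP -> _|jk kh]; first exact: lepm_refl.
by case/andP: (mexp_lt jk kh).
Qed.

Lemma mexp_mlt j k : (j < k)%N -> (k < h)%N -> mlt (mexp j) (mexp k).
Proof.
move=> jk kh; case/andP: (mexp_lt jk kh) => /eqP ne le.
by case: (lem_mlt le).
Qed.

(** The group that fixes the first [k] characteristic monomials. *)
Definition W k : {set torsion e n} := annih n m [pred j : 'I_h | j < k]%N.

Lemma WP k w : reflect (forall j, (j < k)%N -> (j < h)%N -> pairing w (mexp j) = 0)
                       (w \in W k).
Proof.
apply: (iffP (annihP _ _ _)) => H j.
  by move=> jk jh; rewrite (mexpE (Ordinal jh)); apply: H.
by move=> jk; rewrite -mexpE; apply: H.
Qed.

Lemma W_sub k : subtorsion (W k).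
Proof.
split; first by apply/WP => j _ _; apply: pairing0l.
move=> v w /WP Hv /WP Hw; apply/WP => j jk jh.
by rewrite pairingDl pairingNl Hv ?Hw ?subrr.
Qed.

Lemma W0 k : (0 : torsion e n) \in W k. Proof. by case: (W_sub k). Qed.

Lemma W_mono j k : (j <= k)%N -> W k \subset W j.
Proof.
move=> jk; apply/subsetP => w /WP H; apply/WP => i ij; apply: H.
exact: leq_trans jk.
Qed.

Lemma W_all : W 0 = setT.
Proof. by apply/setP => w; rewrite in_setT; apply/WP. Qed.

(** The index of the first characteristic monomial moved by [w], or [h]. *)
Definition level w : nat := find (fun j => pairing w (mexp j) != 0) (iota 0 h).

Lemma level_pairing w : (level w < h)%N -> pairing w (mexp (level w)) != 0.
Proof.
move=> lt; have hs : has (fun j => pairing w (mexp j) != 0) (iota 0 h).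
  by rewrite has_find size_iota.
by have := nth_find 0%N hs; rewrite nth_iota.
Qed.

Lemma mem_W k w : (k <= h)%N -> (w \in W k) = (k <= level w)%N.
Proof.
move=> kh; apply/WP/idP => [H|le j jk jh].
  rewrite leqNgt; apply/negP => lt.
  have lth : (level w < h)%N by apply: leq_trans kh.
  by have := level_pairing lth; rewrite H ?eqxx.
have jl := leq_trans jk le.
by have := before_find 0%N jl; rewrite nth_iota // => /negbT; rewrite negbK => /eqP.
Qed.

Lemma y_lattice w p : w \in W h -> y p != 0 -> pairing w p = 0.
Proof.
move=> /WP Ww yp; case: m_char => _ _ H _.
apply: (in_lattice_annih (H _ yp)); apply/annihP => j _.
by rewrite -mexpE; apply: Ww.
Qed.

Lemma act_root w : (map_poly pow f).[act w y] = 0.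
Proof.
have -> : map_poly pow f = map_poly (act w) (map_poly pow f).
  by rewrite -map_poly_comp; apply: eq_map_poly => a /=; rewrite act_pow.
by rewrite horner_map y_root rmorph0.
Qed.

Lemma chi_neq1 w p : pairing w p != 0 -> 1 - chi w p != 0.
Proof. by rewrite -(chi_eq1 om_prim) subr_eq0 eq_sym. Qed.

(** The conjugate [act w y] first separates from [y] at the exponent
    [mexp (level w)]; since the difference divides the discriminant, it is this
    monomial times a unit. *)
Lemma conj_diff_supp w p : y p != 0 -> pairing w p != 0 ->
  (level w < h)%N /\ (mexp (level w) <= p)%MM.
Proof.
move=> yp wp; set j := level w.
have jh : (j < h)%N.
  rewrite ltnNge; apply: contra wp => le.
  by apply/eqP; apply: y_lattice yp; rewrite mem_W.
split=> //.
have dE q : (y - act w y) q = (1 - chi w q) * y q.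
  by rewrite -[LHS]/(y q - chi w q * y q) mulrBl mul1r.
have ne : y != act w y.
  rewrite -subr_eq0; apply/eqP => /mpsP/(_ p) /eqP; rewrite dE.
  by rewrite mulf_eq0 (negPf yp) (negPf (chi_neq1 wp)).
have [mu dmu le_mu] :=
  quasi_ordinary_root_diff charK f_monic f_qo ne y_root (act_root w).
have dN q : (y - act w y) q != 0 -> y q != 0 /\ pairing w q != 0.
  rewrite dE mulf_eq0 negb_or => /andP[cq yq]; split=> //.
  by apply: contra cq; rewrite -(chi_eq1 om_prim) => /eqP ->; rewrite subrr.
have mu_j : (mu <= mexp j)%MM.
  apply: le_mu; rewrite dE mulf_neq0 ?mexp_supp ?chi_neq1 //.
  exact: level_pairing.
have [ymu wmu] := dN _ dmu.
have deg : (mdeg (mexp j) <= mdeg mu)%N.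
  rewrite leqNgt; apply/negP => lt; move/eqP: wmu; apply.
  case: m_char => _ _ H _; apply: (in_lattice_annih (H _ ymu)).
  apply/annihP => i /= le_i; rewrite -mexpE.
  have /WP : w \in W j by rewrite mem_W // ltnW.
  apply=> //; rewrite ltnNge; apply/negP => ji.
  have := lem_mdeg (mexp_le ji (ltn_ord i)).
  by rewrite leqNgt mexpE (leq_ltn_trans le_i lt).
have <- : mu = mexp j.
  case: (lem_mlt mu_j) => //; rewrite /mlt ltnNge deg /= => /andP[/eqP dE' lt].
  by have := lem_leo mu_j; rewrite leNgt lt.
by apply: le_mu; rewrite dE mulf_neq0 ?chi_neq1.
Qed.

(** The part of [y] that is fixed by [W k] *)
Definition trunc k : R :=
  Mps (fun p => if [forall w in W k, pairing w p == 0] then y p else 0).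

Lemma trunc_supp k p : trunc k p != 0 ->
  [/\ y p != 0, trunc k p = y p & forall w, w \in W k -> pairing w p = 0].
Proof.
rewrite /=; case: forall_inP => [H yp|_]; last by rewrite eqxx.
by split=> // w /H /eqP.
Qed.

Lemma trunc_mexp j k : (j < k)%N -> (k <= h)%N -> trunc k (mexp j) = y (mexp j).
Proof.
move=> jk kh; rewrite /=; case: forall_inP => // -[] w /WP H.
by rewrite H //; apply: leq_trans kh.
Qed.

(** An exponent of [y] moved by some [w] in [W k] lies above the exponent at
    [level w], and [level w] is at least [k]. *)
Lemma tail_supp k p : (y - trunc k) p != 0 -> (k < h)%N /\ (mexp k <= p)%MM.
Proof.
rewrite -[mpscoef _ _]/(y p - trunc k p) /=.
case: forall_inP => [_|nall]; first by rewrite subrr eqxx.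
rewrite subr0 => yp.
have [w Ww wp] : exists2 w, w \in W k & pairing w p != 0.
  apply: contrapT => H; apply: nall => w Ww; apply/negPn/negP => wp.
  by apply: H; exists w.
have [lh le] := conj_diff_supp yp wp.
have kl : (k <= level w)%N.
  have [kh|hk] := leqP k h; first by rewrite -mem_W.
  suff : w \in W h by rewrite mem_W // leqNgt lh.
  by apply: subsetP Ww; apply: W_mono; apply: ltnW.
split; first exact: leq_ltn_trans kl lh.
exact: lepm_trans (mexp_le kl lh) le.
Qed.

Lemma trunc_full : trunc h = y.
Proof.
apply/esym/eqP; rewrite -subr_eq0; apply/eqP/mpsP => p.
by apply/eqP/negPn/negP => /tail_supp; rewrite ltnn => -[].
Qed.

Lemma act_trunc k w : (k <= h)%N -> (act w (trunc k) == trunc k) = (w \in W k).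
Proof.
move=> kh; apply/eqP/idP => [E|Ww]; last first.
  apply/mpsP => p; rewrite actE; have [->|nz] := eqVneq (trunc k p) 0.
    by rewrite mulr0.
  have [_ _ H] := trunc_supp nz.
  by have /eqP -> : chi w p == 1; rewrite ?mul1r // (chi_eq1 om_prim) H.
apply/WP => j jk jh; have nz := mexp_supp jh.
have /eqP := (mpsP _ _).2 E (mexp j).
rewrite actE trunc_mexp // -subr_eq0 -[X in _ - X]mul1r -mulrBl mulf_eq0.
by rewrite (negPf nz) orbF subr_eq0 (chi_eq1 om_prim) => /eqP.
Qed.

Lemma act_trunc_eq k v w : (k <= h)%N ->
  (act v (trunc k) == act w (trunc k)) = (v - w \in W k).
Proof.
move=> kh; rewrite -act_trunc // -(inj_eq (@act_inj e n K om om_prim (- w))) -!actD.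
by rewrite addNr act0 addrC.
Qed.

Definition conjs k : seq R := undup [seq act w (trunc k) | w <- enum (W 0)].
(** The degree of the minimal polynomial of [trunc k]. *)
Definition N k := size (conjs k).
(** The minimal polynomial of [trunc k] over the series in [t^n.+1] *)
Definition conj_poly k : {poly R} := \prod_(u <- conjs k) ('X - u%:P).

Lemma card_conjs j k : (j <= k)%N -> (k <= h)%N ->
  #|W j| = (size (undup [seq act w (trunc k) | w <- enum (W j)]) * #|W k|)%N.
Proof.
move=> jk kh; apply: card_fibres (W_sub j) (W_mono jk) _ => v w _ _.
exact: act_trunc_eq.
Qed.

Lemma N_card k : (k <= h)%N -> #|W 0| = (N k * #|W k|)%N.
Proof. exact: card_conjs. Qed.

Lemma W_gt0 k : (0 < #|W k|)%N.
Proof. by apply/card_gt0P; exists 0; apply: W0. Qed.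

(** The gcd-sequence; see [char_gcd_card]. *)
Definition d k := (#|W k| %/ #|W h|)%N.

Lemma W_ratio k : (k <= h)%N -> #|W k| = (d k * #|W h|)%N.
Proof.
by move=> kh; rewrite /d divnK // (card_conjs kh (leqnn h)) dvdn_mull.
Qed.

Lemma N_gt0 k : (k <= h)%N -> (0 < N k)%N.
Proof. by move=> /N_card E; move: (W_gt0 0); rewrite E muln_gt0 => /andP[]. Qed.

Lemma N_d k : (k <= h)%N -> (N k * d k)%N = N h.
Proof.
move=> kh; apply/eqP; rewrite -(eqn_pmul2r (W_gt0 h)) -mulnA -W_ratio //.
by rewrite -!N_card.
Qed.

(** Products over the whole group are easier to expand than products over the
    distinct conjugates; each conjugate is repeated [#|W k|] times. *)
Lemma conj_poly_powW k : (k <= h)%N ->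
  \prod_(w in W 0) ('X - (act w (trunc k))%:P) = conj_poly k ^+ #|W k|.
Proof.
move=> kh; apply: (prod_fibres (W_sub 0) (W_mono (leq0n k)) _
  (fun u => 'X - u%:P)) => v w _ _.
exact: act_trunc_eq.
Qed.

Lemma conj_poly_monic k : conj_poly k \is monic.
Proof. exact: monic_prod_XsubC. Qed.

Lemma size_conj_poly k : size (conj_poly k) = (N k).+1.
Proof. exact: size_prod_XsubC. Qed.

(** The descent of [conj_poly k], whose coefficients are invariant, to the series in
    [x = t^n.+1]. *)
Definition conj_poly_base k : {poly R} := map_poly (@root_pow e n K) (conj_poly k).

Lemma conj_poly_baseE k : map_poly pow (conj_poly_base k) = conj_poly k.
Proof.
have inv w : map_poly (act w) (conj_poly k) = conj_poly k.
  rewrite rmorph_prod /=.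
  transitivity (\prod_(u <- [seq act w u | u <- conjs k]) ('X - u%:P)).
    rewrite big_map; apply: eq_bigr => u _.
    by rewrite rmorphB /= map_polyX map_polyC.
  apply: perm_big; apply: uniq_perm; rewrite ?undup_uniq //.
    by rewrite map_inj_uniq ?undup_uniq //; apply: act_inj.
  have memE u : (u \in conjs k) = [exists v, u == act v (trunc k)].
    rewrite mem_undup; apply/mapP/existsP => [[v _ ->]|[v /eqP ->]].
      by exists v.
    by exists v; rewrite ?mem_enum // W_all in_setT.
  move=> u; apply/mapP/idP.
    case=> u'; rewrite !memE => /existsP[v /eqP ->] ->.
    by apply/existsP; exists (w + v); rewrite actD.
  rewrite memE => /existsP[v /eqP ->]; exists (act (- w + v) (trunc k)).
    by rewrite memE; apply/existsP; exists (- w + v).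
  by rewrite -actD addrA addrN add0r.
apply/polyP => i; rewrite coef_map_id0 ?rmorph0 //.
rewrite coef_map_id0; last by apply/mpsP.
apply: (@act_invariant e n K om om_prim ((conj_poly k)`_i)) => w.
by rewrite -[in RHS](inv w) coef_map.
Qed.

Lemma conj_poly_base_monic k : conj_poly_base k \is monic.
Proof.
have := conj_poly_monic k; rewrite !monicE -{1}conj_poly_baseE.
have [z|nz] := eqVneq (lead_coef (conj_poly_base k)) 0.
  move/eqP: z; rewrite lead_coef_eq0 => /eqP ->.
  by rewrite rmorph0 lead_coef0.
rewrite lead_coef_map_eq => [|]; last first.
  by rewrite -(rmorph0 pow) (inj_eq (@mps_pow_inj e K n)).
by rewrite -{1}(rmorph1 pow) (inj_eq (@mps_pow_inj e K n)).
Qed.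

Lemma size_conj_poly_base k : size (conj_poly_base k) = (N k).+1.
Proof.
rewrite -size_conj_poly -[in RHS]conj_poly_baseE.
by rewrite [RHS]size_map_inj_poly ?rmorph0 //; apply: mps_pow_inj.
Qed.

Lemma map_pow_inj : injective (map_poly pow).
Proof. exact: map_inj_poly (@mps_pow_inj e K n) (rmorph0 _). Qed.

(** All the conjugates of [y] are roots of [f], so the minimal polynomial of [y]
    divides the irreducible [f]. *)
Lemma f_conj_poly : map_poly pow f = conj_poly h.
Proof.
set g := conj_poly_base h; have gm : g \is monic := conj_poly_base_monic h.
have gE : map_poly pow g = conj_poly h := conj_poly_baseE h.
have [Q QE] : exists Q, map_poly pow f = Q * conj_poly h.
  apply: prod_XsubC_factor; first exact: undup_uniq.
  apply/allP => u; rewrite mem_undup => /mapP[w _ ->].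
  by rewrite trunc_full; apply/rootP/act_root.
have fE : f = Pdiv.Ring.rdivp f g * g + Pdiv.Ring.rmodp f g.
  exact: Pdiv.RingMonic.rdivp_eq.
have r0 : Pdiv.Ring.rmodp f g = 0.
  apply: map_pow_inj; rewrite rmorph0; set rem := map_poly _ _.
  have remE : rem = (Q - map_poly pow (Pdiv.Ring.rdivp f g)) * conj_poly h.
    have E : map_poly pow f =
        map_poly pow (Pdiv.Ring.rdivp f g) * conj_poly h + rem.
      by rewrite {1}fE rmorphD rmorphM /= gE.
    by rewrite mulrBl -QE E addrC addKr.
  apply/eqP; apply: contraT => nz.
  have : (size rem < size (conj_poly h))%N.
    rewrite -gE [X in (_ < X)%N]size_map_inj_poly ?rmorph0 //; last exact: mps_pow_inj.
    rewrite size_map_inj_poly ?rmorph0 //; last exact: mps_pow_inj.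
    by rewrite Pdiv.Ring.ltn_rmodp monic_neq0.
  move: nz; rewrite remE mulf_eq0 negb_or => /andP[c0 h0].
  by rewrite size_mul // ltnNge (polySpred c0) leq_addl.
have [_ _ irr] := f_irr.
rewrite r0 addr0 in fE; have [uq|ug] := irr _ _ fE; last first.
  by move: ug; rewrite poly_unitE size_conj_poly_base eqSS eqn0Ngt N_gt0.
move: uq; rewrite poly_unitE => /andP[/size_poly1P[c c0 qE] _].
have c1 : c = 1.
  by move/monicP: f_monic; rewrite fE qE mul_polyC lead_coefZ (monicP gm) mulr1.
by rewrite fE qE c1 mul1r.
Qed.

Lemma N_full : N h = n.+1.
Proof.
have := congr1 (fun P : {poly R} => size P) f_conj_poly.
rewrite size_conj_poly size_map_inj_poly ?rmorph0 //; last exact: mps_pow_inj.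
by rewrite f_deg => -[].
Qed.

(** * Leading forms at a truncation of the root *)

(** At [k = h] there is no exponent left, and [sub h] is the evaluation at [y] *)
Definition tm k : R := if (k < h)%N then mpsX K (mexp k) else 0.

Definition sub k (P : {poly R}) : {poly R} := P \Po ((trunc k)%:P + tm k *: 'X).

Lemma subM k P Q : sub k (P * Q) = sub k P * sub k Q.
Proof. exact: rmorphM. Qed.

Lemma subD k P Q : sub k (P + Q) = sub k P + sub k Q.
Proof. exact: rmorphD. Qed.

Lemma subX k P i : sub k (P ^+ i) = sub k P ^+ i.
Proof. exact: rmorphXn. Qed.

Lemma sub_sum k (I : Type) (r : seq I) (S : pred I) (F : I -> {poly R}) :
  sub k (\sum_(i <- r | S i) F i) = \sum_(i <- r | S i) sub k (F i).
Proof. exact: rmorph_sum. Qed.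

Lemma sub_prod k (I : Type) (r : seq I) (S : pred I) (F : I -> {poly R}) :
  sub k (\prod_(i <- r | S i) F i) = \prod_(i <- r | S i) sub k (F i).
Proof. exact: rmorph_prod. Qed.

Lemma lead_tm k : (k < h)%N -> lead (tm k *: 'X) (mexp k) 'X.
Proof.
move=> kh; rewrite -[mexp k]addm0 -[X in lead _ _ X]scale1r.
apply: leadZ (@lead_var _ _); rewrite /tm kh /= ?eqxx //.
by move=> s; case: eqP => // ->; rewrite mltxx.
Qed.

Lemma mexp_separated k : (k < h)%N ->
  exists2 w, w \in W k & pairing w (mexp k) != 0.
Proof.
move=> kh; case: m_char => _ _ _ /(_ (Ordinal kh)).
move/(not_in_lattice_annih (i := widen_ord (leqnSn h) (Ordinal kh))).
by case=> w Ww; rewrite -mexpE; exists w.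
Qed.

(** At an element [w] outside [W k] the constant term [trunc k - act w u] dominates,
    and starts where [y] and [act w y] separate; inside [W k] it starts together
    with [t^(mexp k) Z], or later. The exponent does not depend on [u], which
    allows the comparison of [trunc k] with [y]. *)
Lemma lead_conj_factor k u c : (k < h)%N ->
    (forall p, (u - trunc k) p != 0 -> (mexp k <= p)%MM) ->
    (u - trunc k) (mexp k) = c -> forall w,
  lead (sub k ('X - (act w u)%:P)) (mexp (minn k (level w)))
    (if w \in W k then 'X - (chi w (mexp k) * c)%:P
     else ((1 - chi w (mexp (level w))) * y (mexp (level w)))%:P).
Proof.
move=> kh ule uc w; have kh' := ltnW kh.
have -> : sub k ('X - (act w u)%:P) = (trunc k - act w u)%:P + tm k *: 'X.
  by rewrite /sub rmorphB /= comp_polyX comp_polyC polyCB addrAC.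
have low p : act w (u - trunc k) p != 0 -> (mexp k <= p)%MM.
  by rewrite actE mulf_eq0 negb_or => /andP[_ /ule].
have uE : trunc k - act w u = (trunc k - act w (trunc k)) - act w (u - trunc k).
  by rewrite raddfB /= opprB addrA subrK.
rewrite mem_W //; case: leqP => [kl|lk].
  have /eqP tE : act w (trunc k) == trunc k by rewrite act_trunc // mem_W.
  rewrite uE tE subrr sub0r addrC polyCN; apply: leadB (lead_tm kh) _.
  by apply: leadC; [apply: supp_low | rewrite actE uc].
have lh := ltn_trans lk kh.
rewrite -[X in lead _ _ X]addr0; apply: leadD; last first.
  by apply: lead_lt (lead_tm kh) _; apply: mexp_mlt.
have dE p : (trunc k - act w (trunc k)) p = (1 - chi w p) * trunc k p.
  by rewrite -[LHS]/(trunc k p - chi w p * trunc k p) mulrBl mul1r.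
have aE a b p : ((a : R) - b) p = a p - b p by [].
apply: leadC.
  apply: supp_low => p; rewrite uE aE.
  have [->|nz _] := eqVneq (act w (u - trunc k) p) 0; last first.
    exact: lepm_trans (mexp_le (ltnW lk) kh) (low _ nz).
  rewrite subr0 dE mulf_eq0 negb_or => /andP[cp /trunc_supp[yp _ _]].
  have wp : pairing w p != 0.
    by apply: contra cp; rewrite -(chi_eq1 om_prim) => /eqP ->; rewrite subrr.
  by case: (conj_diff_supp yp wp).
rewrite uE aE dE trunc_mexp //.
suff -> : act w (u - trunc k) (mexp (level w)) = 0 by rewrite subr0.
by apply: (supp_low low); apply: mexp_mlt.
Qed.

(** The exponent and the scalar of the product of these leading forms *)
Definition lead_exp_sum k : 'X_{1..e} :=
  (\sum_(w <- enum (W 0)) mexp (minn k (level w)))%MM.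

Definition lead_scalar k : K := \prod_(w <- enum (W 0) | w \notin W k)
  ((1 - chi w (mexp (level w))) * y (mexp (level w))).

Lemma lead_scalar_neq0 k : (k < h)%N -> lead_scalar k != 0.
Proof.
move=> kh; rewrite prodf_seq_neq0; apply/allP => w _; apply/implyP.
rewrite mem_W ?(ltnW kh) // -ltnNge => lk.
have lh := ltn_trans lk kh.
by rewrite mulf_neq0 ?chi_neq1 ?level_pairing ?mexp_supp.
Qed.

Lemma lead_conj_prod k u c : (k < h)%N ->
    (forall p, (u - trunc k) p != 0 -> (mexp k <= p)%MM) ->
    (u - trunc k) (mexp k) = c ->
  lead (sub k (\prod_(w in W 0) ('X - (act w u)%:P))) (lead_exp_sum k)
    (lead_scalar k *: \prod_(w in W k) ('X - (chi w (mexp k) * c)%:P)).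
Proof.
move=> kh ule uc; rewrite -big_enum sub_prod.
apply: lead_ext (lead_prod _ (lead_conj_factor kh ule uc)) _.
rewrite (bigID (mem (W k))) /= mulrC -mul_polyC; congr (_ * _).
  rewrite /lead_scalar rmorph_prod; apply: eq_bigr => w /negPf wk.
  by rewrite /= wk.
rewrite [LHS]big_enum_cond; apply: eq_big => [w|w /andP[_ ->] //].
by apply/andP/idP => [[] //|wk]; split=> //; apply: subsetP wk; apply: W_mono.
Qed.

Lemma mulmn_mul p j k : ((p *+ j) *+ k = p *+ (j * k))%MM.
Proof. by apply/mnmP => i; rewrite !mulmnE mulnA. Qed.

(** Raised to the powers [#|W k|] and [#|W h|], both polynomials become products
    over the whole torsion group, whose factors start with the same exponents. *)
Lemma lead_conj_polys k : (k < h)%N ->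
  exists r c B, [/\ c != 0, B != 0, lead (sub k (conj_poly k)) r (c *: 'X) &
    lead (sub k (conj_poly h)) (r *+ d k)%MM B].
Proof.
move=> kh; have kh' := ltnW kh.
have C0 := lead_scalar_neq0 kh.
have l1 : lead (sub k (conj_poly k) ^+ #|W k|) (lead_exp_sum k)
    (lead_scalar k *: 'X^#|W k|).
  rewrite -subX -conj_poly_powW //.
  have H p : (trunc k - trunc k) p != 0 -> (mexp k <= p)%MM.
    by rewrite subrr eqxx.
  have H0 : (trunc k - trunc k) (mexp k) = 0 by rewrite subrr.
  apply: lead_ext (lead_conj_prod kh H H0) _; congr (_ *: _).
  rewrite (eq_bigr (fun=> 'X)) => [|w _]; last by rewrite mulr0 subr0.
  by rewrite prodr_const.
have l2 : lead (sub k (conj_poly h) ^+ #|W h|) (lead_exp_sum k)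
    (lead_scalar k *: \prod_(w in W k) ('X - (chi w (mexp k) * y (mexp k))%:P)).
  rewrite -subX -conj_poly_powW // trunc_full.
  apply: (lead_conj_prod kh) => [p /tail_supp[]//|].
  rewrite -[LHS]/(y (mexp k) - trunc k (mexp k)).
  suff -> : trunc k (mexp k) = 0 by rewrite subr0.
  apply/eqP/negPn/negP => /trunc_supp[_ _ H].
  have [w Ww] := mexp_separated kh.
  by rewrite H ?eqxx.
have Xn0 i : lead_scalar k *: 'X^i != 0 :> {poly K}.
  by rewrite scaler_eq0 negb_or C0 -size_poly_gt0 size_polyXn.
have pr0 : lead_scalar k *: \prod_(w in W k) ('X - (chi w (mexp k) * y (mexp k))%:P)
    != 0 :> {poly K}.
  rewrite scaler_eq0 negb_or C0; apply/prodf_neq0 => w _.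
  by rewrite polyXsubC_eq0.
have expn_neq0 (P : {poly R}) i : (0 < i)%N -> P ^+ i != 0 -> P != 0.
  by move=> i0; apply: contraNneq => ->; rewrite expr0n eqn0Ngt i0.
have [r [A [lA A0]]] := lead_ex (expn_neq0 _ _ (W_gt0 k) (lead_neq0 l1 (Xn0 _))).
have [q [B [lB B0]]] := lead_ex (expn_neq0 _ _ (W_gt0 h) (lead_neq0 l2 pr0)).
have [rE AE] := lead_uniq (leadX #|W k| lA) l1 (expf_neq0 _ A0) (Xn0 _).
have [qE _] := lead_uniq (leadX #|W h| lB) l2 (expf_neq0 _ B0) pr0.
have qr : q = (r *+ d k)%MM.
  have := W_gt0 h; case E : #|W h| => [//|c] _.
  by apply: (@mulmnI e c); rewrite /= mulmn_mul -E -W_ratio // rE qE.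
have sA : size A = 2.
  have := congr1 (fun P : {poly K} => (size P).-1) AE.
  rewrite size_exp size_scale // size_polyXn /= -[X in _ = X]mul1n => /eqP.
  rewrite eqn_pmul2r ?W_gt0 // => /eqP s1.
  by rewrite (polySpred A0) s1.
have A0E : A`_0 = 0.
  have /eqP := congr1 (fun P : {poly K} => P.[0]) AE.
  rewrite horner_exp hornerZ hornerXn expr0n eqn0Ngt W_gt0 mulr0 expf_eq0.
  by rewrite horner_coef0 => /andP[_ /eqP].
exists r, A`_1, B; split=> //; last by rewrite -qr.
  by move: A0; rewrite -lead_coef_eq0 lead_coefE sA.
apply: lead_ext lA _; apply/polyP => i; rewrite coefZ coefX.
case: i => [|[|i]]; rewrite ?mulr1 ?mulr0 //.
by rewrite nth_default // sA.
Qed.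

(** [g (t^n.+1, trunc k + t^(mexp k) Z)] *)
Definition phi k (g : {poly R}) : {poly R} := sub k (map_poly pow g).

Lemma phiM k a b : phi k (a * b) = phi k a * phi k b.
Proof. by rewrite /phi rmorphM subM. Qed.

Lemma phiD k a b : phi k (a + b) = phi k a + phi k b.
Proof. by rewrite /phi rmorphD subD. Qed.

Lemma phiX k a i : phi k (a ^+ i) = phi k a ^+ i.
Proof. by rewrite /phi rmorphXn subX. Qed.

Lemma phi0 k : phi k 0 = 0.
Proof. by rewrite /phi rmorph0 /sub comp_poly0. Qed.

Lemma phi1 k : phi k 1 = 1.
Proof. by rewrite /phi rmorph1 /sub comp_polyC. Qed.

Lemma phi_sum k (I : Type) (r : seq I) (S : pred I) (F : I -> {poly R}) :
  phi k (\sum_(i <- r | S i) F i) = \sum_(i <- r | S i) phi k (F i).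
Proof. by rewrite /phi rmorph_sum sub_sum. Qed.

Lemma phiC k (a : R) : phi k a%:P = (pow a)%:P.
Proof. by rewrite /phi map_polyC /sub comp_polyC. Qed.

Definition is_lead_exp k (r : 'X_{1..e}) : Prop := exists c B,
  [/\ c != 0, B != 0, lead (phi k (conj_poly_base k)) r (c *: 'X)
    & lead (phi k f) (r *+ d k)%MM B].

(** The [k]-th generator of the semigroup, at which both the minimal polynomial of
    [trunc k] and the approximate root start. *)
Definition rexp k : 'X_{1..e} := classical_sets.xget 0%MM (is_lead_exp k).

Lemma rexpP k : (k < h)%N -> is_lead_exp k (rexp k).
Proof.
move=> kh; have [r [c [B [c0 B0 l1 l2]]]] := lead_conj_polys kh.
rewrite /rexp; case: classical_sets.xgetP => [//|/(_ r)[]].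
by exists c, B; split=> //; rewrite /phi ?conj_poly_baseE ?f_conj_poly.
Qed.

(** What the minimal polynomial of [trunc k] shares with the approximate root. *)
Definition semiroot k (g : {poly R}) : Prop :=
  [/\ g \is monic, size g = (N k).+1
    & exists2 c, c != 0 & lead (phi k g) (rexp k) (c *: 'X)].

Lemma semiroot_conj_poly k : (k < h)%N -> semiroot k (conj_poly_base k).
Proof.
move=> kh; have [c [B [c0 _ lc _]]] := rexpP kh.
by split; [apply: conj_poly_base_monic | apply: size_conj_poly_base | exists c].
Qed.

(** The automorphism [act w] fixes [trunc k] and multiplies [t^(mexp k)] by a
    root of unity, which can be moved to the variable [Z]. *)
Lemma lead_equivariant k w g p A : (k < h)%N -> w \in W k ->
  lead (phi k g) p A ->
  forall i, A`_i * chi w (mexp k) ^+ i = chi w p * A`_i.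
Proof.
move=> kh Ww lA; set x := chi w (mexp k).
have E : map_poly (act w) (phi k g) = phi k g \Po (cmps e x *: 'X).
  rewrite /phi /sub map_comp_poly -comp_polyA; congr (_ \Po _); last first.
    by rewrite -map_poly_comp; apply: eq_map_poly => a /=; rewrite act_pow.
  rewrite comp_polyD comp_polyC comp_polyZ comp_polyX scalerA.
  rewrite rmorphD /= map_polyC map_polyZ map_polyX /=.
  have /eqP -> : act w (trunc k) == trunc k by rewrite act_trunc // ltnW.
  congr (_ + _ *: _); apply/mpsP => p'; rewrite mulrC cmps_mulE actE /tm kh /=.
  by case: eqP => [->|_]; rewrite ?mulr0.
have lx : lead (cmps e x *: 'X) 0%MM (x *: 'X).
  by apply: lead_ext (leadZ0 _ (@lead_var _ _)) _; rewrite /= eqxx.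
have l1 := act_lead om_prim w lA.
have l2 := lead_comp lA lx.
move=> i; have := (l1 i).2; rewrite E (l2 i).2 coefZ => <-.
rewrite comp_polyE coef_sum; have [iA|Ai] := ltnP i (size A).
  rewrite (bigD1 (Ordinal iA)) //= exprZn coefZ coefZ coefXn eqxx mulr1.
  rewrite big1 ?addr0 // => j ji; rewrite exprZn coefZ coefZ coefXn eq_sym.
  by rewrite -[nat_of_ord j == i]/(nat_of_ord j == Ordinal iA) (inj_eq val_inj)
       (negPf ji) !mulr0.
rewrite nth_default // mul0r big1 // => j _.
rewrite exprZn coefZ coefZ coefXn; case: eqP => [ij|]; last by rewrite !mulr0.
by have := ltn_ord j; rewrite -ij ltnNge Ai.
Qed.

(** The next truncation is the substitution for [Z] of its value in [y], whose
    constant term is the coefficient of [y] at [mexp k], plus a multiple of a new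
    variable. *)
Lemma phi_step k : (k < h)%N -> exists2 Q, lead Q 0%MM (y (mexp k))%:P &
  forall g, phi k.+1 g = phi k g \Po Q.
Proof.
move=> kh; pose z : R := Mps (fun p => (trunc k.+1 - trunc k) (p + mexp k)%MM).
pose s : R := if (k.+1 < h)%N then mpsX K (mexp k.+1 - mexp k)%MM else 0.
have tE (a b : R) p : (a - b) p = a p - b p by [].
have zE : trunc k.+1 - trunc k = tm k * z.
  rewrite /tm kh; apply: mpsX_divides => p.
  have -> : (trunc k.+1 - trunc k) p = (y - trunc k) p - (y - trunc k.+1) p.
    by rewrite !tE opprB [RHS]addrC addrA subrK.
  have [->|nz _] := eqVneq ((y - trunc k.+1) p) 0; last first.
    have [kh' le] := tail_supp nz.
    exact: lepm_trans (mexp_le (leqnSn k) kh') le.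
  by rewrite subr0 => /tail_supp[].
have sE : tm k.+1 = tm k * s.
  rewrite /tm kh /s; case: ltnP => kh'; last by rewrite mulr0.
  rewrite -mpsXD; congr mpsX; rewrite addmC submK //.
  exact: mexp_le (leqnSn k) kh'.
exists (z%:P + s *: 'X).
  rewrite -[X in lead _ _ X]addr0; apply: leadD.
    apply: lead_ext (leadC0 _) _; congr _%:P.
    rewrite -[LHS]/((trunc k.+1 - trunc k) (0 + mexp k)%MM) add0m tE trunc_mexp //.
    suff -> : trunc k (mexp k) = 0 by rewrite subr0.
    apply/eqP/negPn/negP => /trunc_supp[_ _ H].
    by have [w Ww] := mexp_separated kh; rewrite H ?eqxx.
  apply: lead_ext (leadZ0 _ (@lead_var _ _)) _.
  suff -> : s 0%MM = 0 by rewrite scale0r.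
  rewrite /s; case: ltnP => // kh' /=; case: eqP => // E.
  have := submK (mexp_le (leqnSn k) kh'); rewrite -E add0m => E'.
  by have /andP[/eqP] := mexp_lt (ltnSn k) kh'.
move=> g; rewrite /phi /sub -comp_polyA; congr (_ \Po _).
rewrite comp_polyD comp_polyC comp_polyZ comp_polyX scalerDr scalerA -sE.
have e1 : tm k *: z%:P = (trunc k.+1 - trunc k)%:P.
  by rewrite zE polyCM mul_polyC.
by rewrite e1 addrA -polyCD [trunc k + _]addrC subrK.
Qed.

(** * Polynomials of small degree *)

Definition generated k p : Prop := exists (gamma : 'I_e -> nat) (theta : nat -> nat),
  p = ((\sum_(i < e) (U_(i) *+ n.+1) *+ gamma i)
       + (\sum_(j < k) rexp j *+ theta j))%MM.

Lemma generated_mul k p : generated k (p *+ n.+1)%MM.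
Proof.
exists (fun i => p i), (fun=> 0%N); rewrite [X in (_ + X)%MM]big1 ?addm0 //.
apply/mnmP => l; rewrite mulmnE mnm_sumE (bigD1 l) //= big1 => [|i il].
  by rewrite !mulmnE mnm1E eqxx addn0 mul1n mulnC.
by rewrite !mulmnE mnm1E (negPf il).
Qed.

Lemma generated_rexp k p : generated k p -> forall i, generated k.+1 (p + rexp k *+ i)%MM.
Proof.
move=> [g [t ->]] i; exists g, (fun j => if (j < k)%N then t j else i).
rewrite big_ord_recr /= ltnn addmA; congr (_ + _ + _)%MM.
by apply: eq_bigr => j _; rewrite ltn_ord.
Qed.

(** The order of [mexp k] modulo the lattice generated by [n.+1] and the
   previous exponents *)
Definition char_order k : nat :=
  size (undup [seq chi w (mexp k) | w <- enum (W k)]).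

Lemma char_order_card k : (k < h)%N -> #|W k| = (char_order k * #|W k.+1|)%N.
Proof.
move=> kh; apply: card_fibres (W_sub k) (W_mono (leqnSn k)) _ => v w Wv Ww.
have -> : (v - w \in W k.+1) = (pairing (v - w) (mexp k) == 0).
  have /WP Wd : v - w \in W k by apply: (W_sub k).2.
  apply/WP/eqP => [H|H j]; first exact: H.
  by rewrite ltnS leq_eqVlt => /orP[/eqP ->|jk] // jh; apply: Wd.
rewrite -(chi_eq1 om_prim).
rewrite -[RHS](inj_eq (mulIf (chi_neq0 om_prim w (mexp k)))) mul1r.
by rewrite -(chiDl om_prim) subrK.
Qed.

Lemma N_step k : (k < h)%N -> N k.+1 = (N k * char_order k)%N.
Proof.
move=> kh; apply/eqP; rewrite -(eqn_pmul2r (W_gt0 k.+1)) -mulnA.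
by rewrite -char_order_card // -!N_card // ltnW.
Qed.

(** The values [chi w (mexp k)] are [char_order k] distinct roots of [X^i - 1]. *)
Lemma char_order_min k i : (0 < i)%N ->
  (forall w, w \in W k -> chi w (mexp k) ^+ i = 1) -> (char_order k <= i)%N.
Proof.
move=> i0 H; apply: max_unity_roots i0 _ (undup_uniq _).
apply/allP => x; rewrite mem_undup => /mapP[w]; rewrite mem_enum => Ww ->.
by apply/unity_rootP; apply: H.
Qed.

(** Polynomials of degree less than that of [trunc k] cannot separate [trunc k] from
    the series that continue it. *)
Definition const_lead k : Prop := forall a : {poly R},
  a != 0 -> (size a <= N k)%N ->
  exists p c, [/\ c != 0, generated k p & lead (phi k a) p c%:P].

Lemma semiroot_equivariant k g w : (k < h)%N -> semiroot k g -> w \in W k ->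
  chi w (rexp k) = chi w (mexp k).
Proof.
move=> kh [_ _ [c c0 l]] Ww; have := lead_equivariant kh Ww l 1.
by rewrite coefZ coefX mulr1 expr1 mulrC => /(mulIf c0).
Qed.

Lemma const_equivariant k a p c w : (k < h)%N -> c != 0 ->
  lead (phi k a) p c%:P -> w \in W k -> chi w p = 1.
Proof.
move=> kh c0 l Ww; have := lead_equivariant kh Ww l 0.
by rewrite coefC mulr1 -{1}[c]mul1r => /(mulIf c0).
Qed.

(** In an expansion with respect to a semiroot, the terms start with
    distinct powers of [Z], so the expansion starts with the smallest term. *)
Lemma expansion_lead k g E (b : nat -> {poly R}) : (k < h)%N ->
    const_lead k -> semiroot k g -> (forall i, (size (b i) <= N k)%N) ->
    (exists i : 'I_E, b i != 0) ->
  exists (p : 'I_E -> 'X_{1..e}) (c : 'I_E -> K) (i0 : 'I_E),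
  [/\ forall i : 'I_E, b i != 0 -> [/\ c i != 0, generated k (p i),
        (forall w, w \in W k -> chi w (p i) = 1) &
        lead (phi k (b i * g ^+ i)) (p i + rexp k *+ i)%MM (c i *: 'X^i)],
      b i0 != 0,
      forall i : 'I_E, b i != 0 ->
        ~~ mlt (p i + rexp k *+ i)%MM (p i0 + rexp k *+ i0)%MM &
      lead (phi k (\sum_(i < E) b i * g ^+ i)) (p i0 + rexp k *+ i0)%MM
        (\sum_(i : 'I_E | (b i != 0) &&
                (p i + rexp k *+ i == p i0 + rexp k *+ i0)%MM) c i *: 'X^i)].
Proof.
move=> kh Sk [gm sg [c0 c0n lg]] bN exb.
have ex (i : 'I_E) : exists pc : 'X_{1..e} * K, b i != 0 ->
   [/\ pc.2 != 0, generated k pc.1, (forall w, w \in W k -> chi w pc.1 = 1) &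
       lead (phi k (b i * g ^+ i)) (pc.1 + rexp k *+ i)%MM (pc.2 *: 'X^i)].
  have [-> |bi] := eqVneq (b i) 0; first by exists (0%MM, 0).
  have [p [c [cn gp lp]]] := Sk _ bi (bN i).
  exists (p, c * c0 ^+ i) => _; split=> //=.
  - by rewrite mulf_neq0 ?expf_neq0.
  - by move=> w; apply: const_equivariant lp.
  rewrite phiM phiX; apply: lead_ext (leadM lp (leadX i lg)) _.
  by rewrite exprZn mul_polyC scalerA.
have [pc H] := choice ex.
exists (fun i => (pc i).1), (fun i => (pc i).2).
have [||i0 [bi0 min l]] := @lead_sum_distinct e K E (fun i : 'I_E => b i != 0)
  (fun i : 'I_E => phi k (b i * g ^+ i)) (fun i : 'I_E => ((pc i).1 + rexp k *+ i)%MM)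
  (fun i => (pc i).2) _ _ exb.
- by move=> i; rewrite negbK => /eqP ->; rewrite mul0r phi0.
- by move=> i /H[].
by exists i0; split=> //; rewrite phi_sum.
Qed.

(** In the expansion of [a] in powers of the minimal polynomial of [trunc k], two
    terms with the same exponent would have [chi w (mexp k)] raised to the same
    power for all [w] in [W k], which [char_order_min] excludes. *)
Lemma const_lead_step k : (k < h)%N -> const_lead k -> const_lead k.+1.
Proof.
move=> kh Sk a a0; rewrite N_step // => sa.
have gk := semiroot_conj_poly kh.
have [b [bN aE]] := monic_expansion (conj_poly_base_monic k)
  (size_conj_poly_base k) sa.
set g := conj_poly_base k in gk aE; set E := char_order k in aE.
have [i bi] : exists i : 'I_E, b i != 0.
  apply: contrapT => nb; case/eqP: a0; rewrite aE big1 // => i _.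
  by have [->|bi] := eqVneq (b i) 0; rewrite ?mul0r //; case: nb; exists i.
have [p [c [i0 [H bi0 _ l]]]] := expansion_lead kh Sk gk bN (ex_intro _ i bi).
have uniq (j : 'I_E) : b j != 0 ->
    (p j + rexp k *+ j = p i0 + rexp k *+ i0)%MM -> j = i0.
  move=> bj E0; apply: val_inj => /=.
  have chiE w : w \in W k -> chi w (mexp k) ^+ j = chi w (mexp k) ^+ i0.
    move=> Ww; have := congr1 (chi w) E0; rewrite !(chiDr om_prim) !(chiMn om_prim).
    have [_ _ /(_ w Ww) -> _] := H _ bj; have [_ _ /(_ w Ww) -> _] := H _ bi0.
    by rewrite !mul1r (semiroot_equivariant kh gk Ww).
  have aux (x z : 'I_E) : (x < z)%N ->
      (forall w, w \in W k -> chi w (mexp k) ^+ x = chi w (mexp k) ^+ z) -> False.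
    move=> xz Hxz; have := @char_order_min k (z - x)%N; rewrite subn_gt0 => /(_ xz).
    rewrite leqNgt (leq_ltn_trans (leq_subr _ _) (ltn_ord z)) => H'.
    suff : false by []; apply: H' => w Ww.
    apply: (mulfI (expf_neq0 x (chi_neq0 om_prim w (mexp k)))).
    by rewrite -exprD subnKC ?(ltnW xz) // mulr1 Hxz.
  case: (ltngtP j i0) => // lt; exfalso; first exact: aux lt chiE.
  by apply: aux lt _ => w Ww; rewrite chiE.
have [ci gi _ _] := H _ bi0.
have [Q lQ QE] := phi_step kh.
exists (p i0 + rexp k *+ i0)%MM, (c i0 * y (mexp k) ^+ i0); split.
- by rewrite mulf_neq0 ?expf_neq0 ?mexp_supp.
- exact: generated_rexp.
rewrite QE aE; apply: lead_ext (lead_comp l lQ) _.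
rewrite (big_pred1 i0) => [|j].
  by rewrite comp_polyZ rmorphXn /= comp_polyX -mul_polyC polyCM polyC_exp.
apply/andP/eqP => [[bj /eqP]|->]; first exact: uniq.
by rewrite bi0 eqxx.
Qed.

Lemma N_zero : N 0 = 1%N.
Proof.
by have /eqP := N_card (leq0n h); rewrite -[X in X == _]mul1n eqn_pmul2r ?W_gt0 // => /eqP.
Qed.

Lemma const_leadP k : (k <= h)%N -> const_lead k.
Proof.
elim: k => [_|k IH kh]; last by apply: const_lead_step => //; apply/IH/ltnW.
move=> a a0; rewrite N_zero => /size1_polyC aE.
have a00 : (a`_0)%:P != 0 :> {poly R} by rewrite -aE.
have [p [A [lA A0]]] := lead_ex a00.
exists (p *+ n.+1)%MM, (A`_0).
have := lA 0%N; rewrite coefC /= => -[low ap].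
have AE : A = (A`_0)%:P.
  apply/polyP => i; rewrite coefC; case: eqP => [->//|/eqP i0].
  by have := (lA i).2; rewrite coefC (negPf i0) => <-.
split; first by apply: contraNneq A0 => z; rewrite AE z.
  exact: generated_mul.
rewrite aE phiC; apply: leadC; last by rewrite mps_powE.
move=> s lt; apply/eqP/negPn/negP => nz; have [q sE] := mps_pow_supp nz.
by move: nz lt; rewrite sE mps_powE mlt_muln => nz /low ap0; rewrite ap0 eqxx in nz.
Qed.

(** * Approximate roots *)

Lemma d_gt0 k : (k <= h)%N -> (0 < d k)%N.
Proof. by move=> /W_ratio E; move: (W_gt0 k); rewrite E muln_gt0 => /andP[]. Qed.

Lemma N_d_full k : (k <= h)%N -> (N k * d k)%N = n.+1.
Proof. by move=> kh; rewrite N_d // N_full. Qed.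

(** The leading form of [f] has no term in [Z^(d-1)]: by equivariance, two
    consecutive powers of [Z] cannot both occur in it. Hence the correction [q]
    starts after [rexp k], and the Tschirnhausen step keeps the leading form. *)
Lemma semiroot_tschirnhausen k (g q r : {poly R}) (c : R) : (k < h)%N -> semiroot k g ->
    f - g ^+ d k = q * g ^+ (d k).-1 + r -> (size q <= N k)%N ->
    (size r <= N k * (d k).-1)%N ->
  semiroot k (g + c *: q).
Proof.
move=> kh gg fE qN rN; have [-> |q0] := eqVneq q 0; first by rewrite scaler0 addr0.
have kh' := ltnW kh; have Sk := const_leadP kh'.
have [gm sg [c0 c0n lg]] := gg.
suff lq : lead (phi k q) (rexp k) 0.
  have lt : (size (c *: q)%R < size g)%N.
    by rewrite sg ltnS (leq_trans (size_scale_leq _ _)).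
  split; first by rewrite monicE lead_coefDl // -monicE.
    by rewrite size_polyDl.
  exists c0 => //; rewrite phiD -[c *: q]mul_polyC phiM phiC -[X in lead _ _ X]addr0.
  apply: leadD lg _; rewrite -[rexp k]add0m.
  by apply: lead_ext (leadM (leadC0 _) lq) _; rewrite mulr0.
have := d_gt0 kh'; case dE' : (d k) => [//|d'] _; rewrite dE' /= in fE rN.
have [bb [bbN rE]] := monic_expansion gm sg rN.
pose b i := if (i < d')%N then bb i else if i == d' then q else 1.
have bN i : (size (b i) <= N k)%N.
  by rewrite /b; case: ifP => // _; case: ifP => // _; rewrite size_poly1 N_gt0.
have bd : b d' = q by rewrite /b ltnn eqxx.
have bm : b d'.+1 = 1 by rewrite /b ltnNge leqnSn /= eqn_leq ltnn.
have fb : f = \sum_(i < d'.+2) b i * g ^+ i.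
  rewrite !big_ord_recr /= bd bm mul1r -[LHS](subrK (g ^+ d'.+1)) fE.
  congr (_ + _); rewrite addrC rE; congr (_ + _); apply: eq_bigr => i _.
  by rewrite /b ltn_ord.
pose im : 'I_d'.+2 := ord_max; pose iq : 'I_d'.+2 := inord d'.
have iqE : iq = d' :> nat by rewrite inordK.
have b1 : b im != 0 by rewrite bm oner_eq0.
have [p [c' [i0 [H bi0 min l]]]] := expansion_lead kh Sk gg bN (ex_intro _ im b1).
rewrite -fb in l.
have Xn0 (a : K) j : a != 0 -> a *: 'X^j != 0 :> {poly K}.
  by move=> a0; rewrite scaler_eq0 negb_or a0 -size_poly_gt0 size_polyXn.
have Pm : (p im + rexp k *+ d'.+1 = rexp k *+ d'.+1)%MM.
  have [cm _ _ lm] := H im b1.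
  have lm' := leadX d'.+1 lg; rewrite -phiX -[g ^+ _]mul1r -bm in lm'.
  have [] := lead_uniq lm lm' (Xn0 _ _ cm) _; last by [].
  by rewrite exprZn Xn0 // expf_neq0.
have [_ [B [_ B0 _ lf]]] := rexpP kh; rewrite dE' in lf.
set A := (\sum_(_ | _) _) in l.
have A0 : A != 0.
  apply/eqP => /polyP/(_ i0); rewrite coef_sum_monom bi0 eqxx coef0.
  by have [ci _ _ _] := H _ bi0; move/eqP; rewrite (negPf ci).
have [P0 _] := lead_uniq l lf A0 B0; rewrite P0 in l.
have bq : b iq != 0 by rewrite iqE bd.
have [cq _ _ lq] := H _ bq; rewrite iqE bd in lq.
have ne : (p iq + rexp k *+ d')%MM != (rexp k *+ d'.+1)%MM.
  apply/eqP => E; have [w Ww] := mexp_separated kh.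
  rewrite -(chi_eq1 om_prim) => /eqP; apply.
  have := lead_equivariant kh Ww l iq; have := lead_equivariant kh Ww l im.
  rewrite /A !coef_sum_monom b1 bq P0 iqE E Pm /= !eqxx /=.
  have [cm _ _ _] := H _ b1.
  rewrite [_ * c' im]mulrC => /(mulfI cm) <-.
  rewrite [_ * c' iq]mulrC => /(mulfI cq)/esym.
  rewrite exprSr -[X in _ = X]mulr1; apply: mulfI.
  by rewrite expf_neq0 // chi_neq0.
have lt : mlt (rexp k) (p iq).
  have := min _ bq; rewrite P0 iqE => nlt.
  rewrite -(mlt_add2r (rexp k *+ d')%MM) -mulmS.
  by case: (mlt_total (rexp k *+ d'.+1)%MM (p iq + rexp k *+ d')%MM) nlt ne =>
    [//|->|->//]; rewrite eqxx.
have [pq [cq' [cq0 _ lq']]] := Sk _ q0 qN.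
suff pE : p iq = pq by apply: lead_lt lq' _; rewrite -pE.
have lqg := leadM lq' (leadX d' lg); rewrite -phiX -phiM in lqg.
have [] := lead_uniq lq lqg; last by move/addIm.
  exact: Xn0.
by rewrite exprZn mul_polyC scalerA Xn0 // mulf_neq0 ?expf_neq0.
Qed.

Lemma size_monic_sub (S : nzRingType) (P Q : {poly S}) N :
  P \is monic -> Q \is monic -> size P = N.+1 -> size Q = N.+1 ->
  (size (P - Q)%R <= N)%N.
Proof.
move=> mP mQ sP sQ; apply/leq_sizeP => j; rewrite leq_eqVlt coefB.
case/orP => [/eqP <-|lt]; last by rewrite !nth_default ?subr0 ?sP ?sQ.
by have := monicP mP; have := monicP mQ; rewrite !lead_coefE sP sQ => -> ->; rewrite subrr.
Qed.

(** Tschirnhausen steps, starting from the minimal polynomial of [trunc k], lower the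
    degree of [f - g ^+ d k]. *)
Lemma approx_root_exists k : (k < h)%N -> exists g, semiroot k g /\
  (size (f - g ^+ d k)%R <= N k * (d k).-1)%N.
Proof.
move=> kh; have kh' := ltnW kh; have d0 := d_gt0 kh'.
suff H s g : semiroot k g -> (size (f - g ^+ d k)%R <= s)%N ->
    exists g', semiroot k g' /\ (size (f - g' ^+ d k)%R <= N k * (d k).-1)%N.
  exact: H (semiroot_conj_poly kh) (leqnn _).
elim: s g => [|s IH] g gg le; first by exists g; split=> //; apply: leq_trans le _.
case: (leqP (size (f - g ^+ d k)%R) (N k * (d k).-1)) => [?|lt]; first by exists g.
have [gm sg _] := gg.
have [q [r [fE ltr sP]]] := monic_division (f - g ^+ d k) (monic_exp (d k).-1 gm).
rewrite (size_monic_exp _ gm sg) ltnS in ltr.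
have q0 : q != 0.
  by apply: contraTneq lt => q0; rewrite fE q0 mul0r add0r -leqNgt.
have := sP q0; rewrite (size_monic_exp _ gm sg) /= => sE.
have qN : (size q <= N k)%N.
  rewrite -(leq_add2r (N k * (d k).-1)) -sE -mulnS prednK //.
  apply: size_monic_sub => //; first exact: monic_exp.
    by rewrite N_d_full.
  exact: size_monic_exp.
have dn0 : (d k)%:R != 0 :> K by rewrite (pcharf0P K).1 // -lt0n.
pose c : R := cmps e (d k)%:R^-1.
have cd : c * (d k)%:R = 1 by rewrite -cmps_nat -cmpsM mulVf // cmps1.
apply: (IH (g + c *: q)); first exact: semiroot_tschirnhausen fE qN ltr.
rewrite -ltnS; apply: leq_trans le; rewrite sE.
exact: tschirnhausen_size fE q0 qN ltr.
Qed.

Lemma semiroot_approx_root k : (k < h)%N -> semiroot k (approx_root (d k) f).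
Proof.
move=> kh; have kh' := ltnW kh; have d0 := d_gt0 kh'.
have [g [gg gs]] := approx_root_exists kh; have [gm sg _] := gg.
have NE : (n.+1 %/ d k = N k)%N by rewrite -(N_d_full kh') mulnK.
have dE' : (n.+1 - N k = N k * (d k).-1)%N.
  by rewrite -(N_d_full kh') -[X in (_ - X)%N]muln1 -mulnBr subn1.
suff -> : approx_root (d k) f = g by [].
rewrite /approx_root; apply: classical_sets.xget_unique.
  by split; rewrite // f_deg /= NE ?dE'.
move=> g2 []; rewrite f_deg /= NE dE' => g2m sg2 g2s.
apply/eqP; apply: contraT => ne.
have dn0 : (d k)%:R != 0 :> R by apply: mps_nat_neq0.
have := size_exp_diff g2m gm sg2 sg dn0 ne; rewrite ltnNge => /negP[].
have -> : g2 ^+ d k - g ^+ d k = (f - g ^+ d k) - (f - g2 ^+ d k).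
  by rewrite opprB [RHS]addrC addrA subrK.
by apply: leq_trans (size_polyD _ _) _; rewrite geq_max size_polyN gs.
Qed.

(** * Generators of the semigroup *)

Lemma phi_full g : phi h g = (eval_root n.+1 y g)%:P.
Proof.
by rewrite /phi /sub /tm ltnn scale0r addr0 comp_polyCr trunc_full.
Qed.

Lemma lead_const_up j k g p c : (k <= j)%N -> (j <= h)%N ->
  lead (phi k g) p c%:P -> lead (phi j g) p c%:P.
Proof.
move=> /subnK <-; elim: (j - k)%N => [//|i IH] jh l.
have [Q lQ ->] := phi_step (jh : (i + k < h)%N).
apply: lead_ext (lead_comp (IH (ltnW jh) l) lQ) _.
by rewrite comp_polyC.
Qed.

Lemma lead_full_exp g p c : c != 0 -> lead (phi h g) p c%:P ->
  eval_root n.+1 y g != 0 /\ qo_order n.+1 y g = p.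
Proof. by rewrite phi_full; apply: lead_const_exp. Qed.

Lemma semiroot_full k g : (k < h)%N -> semiroot k g ->
  exists2 c, c != 0 & lead (phi h g) (rexp k) c%:P.
Proof.
move=> kh [_ _ [c c0 l]]; have [Q lQ QE] := phi_step kh.
exists (c * y (mexp k)); first by rewrite mulf_neq0 ?mexp_supp.
apply: (lead_const_up kh (leqnn h)); rewrite QE.
apply: lead_ext (lead_comp l lQ) _.
by rewrite comp_polyZ comp_polyX -mul_polyC polyCM.
Qed.

Lemma qo_order_approx_root k : (k < h)%N ->
  qo_order n.+1 y (approx_root (d k) f) = rexp k.
Proof.
move=> kh; have [c c0 l] := semiroot_full kh (semiroot_approx_root kh).
by case: (lead_full_exp c0 l).
Qed.

(** Being the order of some polynomial, in a form that is clearly additive. *)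
Definition attained p : Prop :=
  exists (g : {poly R}) (c : K), c != 0 /\ lead (phi h g) p c%:P.

Lemma attained0 : attained 0%MM.
Proof. by exists 1, 1; rewrite oner_eq0 phi1; split=> //; apply: lead1. Qed.

Lemma attainedD p q : attained p -> attained q -> attained (p + q)%MM.
Proof.
move=> [a [c [c0 l]]] [a' [c' [c0' l']]]; exists (a * a'), (c * c').
by rewrite mulf_neq0 // phiM polyCM; split=> //; apply: leadM.
Qed.

Lemma attainedMn p i : attained p -> attained (p *+ i)%MM.
Proof.
move=> ap; elim: i => [|i IH]; first exact: attained0.
by rewrite mulmS; apply: attainedD.
Qed.

Lemma attained_sum (I : Type) (r : seq I) (F : I -> 'X_{1..e}) :
  (forall i, attained (F i)) -> attained (\sum_(i <- r) F i)%MM.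
Proof.
by move=> H; apply: big_ind => //; [apply: attained0 | apply: attainedD].
Qed.

Lemma attained_var (i : 'I_e) : attained (U_(i) *+ n.+1)%MM.
Proof.
exists (mpsX K U_(i))%:P, 1; rewrite oner_eq0 phiC; split=> //.
apply: leadC; rewrite mps_powX /= ?eqxx // => s.
by case: eqP => // ->; rewrite mltxx.
Qed.

Lemma semigroup_generated p : qo_semigroup n.+1 y p <-> generated h p.
Proof.
split=> [[g g0 ->]|[gam [th ->]]].
  have [q [a [gE sa _]]] := monic_division g f_monic.
  have eE : eval_root n.+1 y g = eval_root n.+1 y a.
    rewrite gE /eval_root rmorphD rmorphM /= hornerD hornerM.
    by rewrite y_root mulr0 add0r.
  have a0 : a != 0.
    by apply: contraNneq g0 => a0; rewrite eE a0 /eval_root rmorph0 horner0.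
  have [|r [c [c0 gr l]]] := const_leadP (leqnn h) a0.
    by rewrite N_full -ltnS -f_deg.
  by have [_ E] := lead_full_exp c0 l; rewrite /qo_order eE -/(qo_order _ _ _) E.
have [g [c [c0 l]]] : attained ((\sum_(i < e) (U_(i) *+ n.+1) *+ gam i)
       + (\sum_(j < h) rexp j *+ th j))%MM.
  apply: attainedD; apply: attained_sum => i; apply: attainedMn.
    exact: attained_var.
  have [c c0 l] := semiroot_full (ltn_ord i) (semiroot_conj_poly (ltn_ord i)).
  by exists (conj_poly_base i), c.
have [g0 <-] := lead_full_exp c0 l.
by exists g.
Qed.

End Conjugates.

Lemma prim_root_exists (K : closedFieldType) (charK : [pchar K] =i pred0) n :
  exists om : K, n.+1.-primitive_root om.
Proof.
pose p : {poly K} := 'X^(n.+1) - 1; have [r Dp] := closed_field_poly_normal p.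
rewrite (monicP _) ?monicXnsubC // scale1r in Dp.
have rn1 : all n.+1.-unity_root r.
  by apply/allP=> z; rewrite -root_prod_XsubC -Dp.
have sz_r : (n.+1 <= size r)%N.
  by rewrite -ltnS -(size_prod_XsubC r id) -Dp size_XnsubC.
have [|om] := hasP (has_prim_root (ltn0Sn n) rn1 _ sz_r); last by exists om.
rewrite -separable_prod_XsubC -Dp; apply: separable_Xn_sub_1.
by rewrite (pcharf0P K).1.
Qed.

Theorem mainTheorem1 (K : closedFieldType) (charK : [pchar K] =i pred0)
    (e n h : nat) (f : {poly mps e K})
    (f_monic : f \is monic) (f_deg : size f = n.+1)
    (f_irr : irreducible_elt f) (f_qo : quasi_ordinary f)
    (y : mps e K) (y_root : eval_root n y f = 0)
    (m : 'I_h -> 'X_{1..e}) (m_char : char_exponents n m y) :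
  forall a : 'X_{1..e},
    qo_semigroup n y a <->
    exists (gamma : 'I_e -> nat) (theta : 'I_h -> nat),
      a = ((\sum_(i < e) (U_(i) *+ n) *+ gamma i) +
           (\sum_(k < h)
              qo_order n y (approx_root (gcd_seq n m (widen_ord (leqnSn h) k)) f)
              *+ theta k))%MM.
Proof.
case: n => [|n] in f_deg y_root m_char *.
  have /size1_polyC fE : (size f <= 1)%N by rewrite f_deg.
  have f1 : f = 1 by have := monicP f_monic; rewrite lead_coefE f_deg /= {2}fE => ->.
  by case: f_irr; rewrite f1 unitr1.
have [om om_prim] := prim_root_exists charK n => a.
have rE (k : 'I_h) :
    qo_order n.+1 y (approx_root (gcd_seq n.+1 m (widen_ord (leqnSn h) k)) f)
    = rexp om_prim f y m k.
  rewrite -(qo_order_approx_root charK om_prim f_monic f_deg f_irr f_qo y_root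
    m_char (ltn_ord k)).
  by rewrite /gcd_seq !char_gcd_card.
apply: (iff_trans (semigroup_generated charK om_prim f_monic f_deg f_irr f_qo y_root
  m_char a)).
split=> [[gamma [theta ->]]|[gamma [theta ->]]].
  exists gamma, (fun k => theta k); congr (_ + _)%MM.
  by apply: eq_bigr => k _; rewrite rE.
exists gamma, (fun j => oapp theta 0%N (insub j)); congr (_ + _)%MM.
by apply: eq_bigr => k _; rewrite rE valK.
Qed.
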